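(* Let $V$ be a finite-dimensional complex vector space. The vector space $$\bigoplus_{p,q\ge0}V^{\otimes p}\otimes_{\mathbb{C}S_p}\mathbb{C}S_\infty\otimes_{\mathbb{C}S_q}V^{*\otimes q}=\bigoplus_{q\ge0}\bar T(V)\otimes_{\mathbb{C}S_q}V^{*\otimes q}$$ is identified with $\mathcal{L}(V)$ as a vector space (i.e. there is a well-defined linear isomorphism) through the correspondence $$v_p\cdots v_1\,\sigma\,v_1^*\cdots v_q^*\ \mapsto\ L(v_p)\cdots L(v_1)L(\sigma)L(v_1^* )\cdots L(v_q^* ),$$ where $v_i\in V$, $v_i^*\in V^*$, $\sigma\in S_\infty$.
   Context: Permutations multiply by composition; $S_\infty$ is the inductive limit of $S_0\subset S_1\subset\cdots$. The symbol $\otimes$ is omitted in tensors. $V^{\otimes p}$ is a right $\mathbb{C}S_p$-module by $v_p\cdots v_1\,\sigma=v_{\sigma(p)}\cdots v_{\sigma(1)}$, and $V^{*\otimes q}$ is a left $\mathbb{C}S_q$-module by $\sigma^{-1}\,v_1^*\cdots v_q^*=v^*_{\sigma(1)}\cdots v^*_{\sigma(q)}$. Put $\bar T_p(V)=V^{\otimes p}\otimes_{\mathbb{C}S_p}\mathbb{C}S_\infty$ and $\bar T(V)=\bigoplus_{p\ge0}\bar T_p(V)$, an associative graded algebra with product $$(v_p\cdots v_1\,\sigma)(v'_{p'}\cdots v'_1\,\sigma')=v_p\cdots v_1v'_{p'}\cdots v'_1\,\alpha^{p'}(\sigma)\sigma',$$ where $\alpha$ is the group endomorphism of $S_\infty$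 with $\alpha(\sigma)(1)=1$, $\alpha(\sigma)(k)=\sigma(k-1)+1$ for $k\ge2$. $\bar T(V)$ is a right $\mathbb{C}S_\infty$-module by right multiplication. $L(\varphi)$ is left multiplication by $\varphi\in\bar T(V)$. For $v^*\in V^*$, $L(v^* )$ is the operator on $\bar T(V)$ with $$L(v^* )\,v_p\cdots v_1\,t=\sum_{k=1}^p\langle v^*,v_k\rangle\,v_p\cdots\hat v_k\cdots v_1\cdot(p\ \,p{-}1\ \cdots\ k{+}1\ \,k)\,t\qquad(t\in\mathbb{C}S_\infty),$$ where $\hat v_k$ means omission and $(p\ p{-}1\cdots k)$ is the cycle $p\mapsto p-1\mapsto\cdots\mapsto k\mapsto p$; $L(v^* )t=0$ for $p=0$. $\mathcal{L}(V)$ is the subalgebra of $\operatorname{End}_{\mathbb{C}}(\bar T(V))$ generated by all $L(v)$, $L(v^* )$, $L(\sigma)$ with $v\in V$, $v^*\in V^*$, $\sigma\in S_\infty$. *)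

(* Defs.v *)
From HB Require Import structures.
From mathcomp Require Import all_boot all_order fingroup perm all_algebra.
From mathcomp Require Import boolp classical_sets.
From mathcomp Require Import finmap monalg.
From mathcomp Require Import prodnormedzmodule reals complex.

Set Implicit Arguments.
Unset Strict Implicit.
Unset Printing Implicit Defensive.

Import GRing.Theory.
Local Open Scope ring_scope.
Local Open Scope classical_set_scope.

Section LinearMaps.
Variables (K : comPzRingType) (U W : lmodType K).
Implicit Types f g h : {linear U -> W}.

Lemma linmap_ext f g : (forall x, f x = g x) -> f = g.
Proof.
case: f => f [[f1] [f2]]; case: g => g [[g1] [g2]] /= fg.
have {fg} E : f = g by apply/funext.
case: _ / E g1 g2 => g1 g2; congr GRing.Linear.Pack.
by rewrite (Prop_irrelevance f1 g1) (Prop_irrelevance f2 g2).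
Qed.

Definition linmap_zero : {linear U -> W} := \0.
Definition linmap_add f g : {linear U -> W} := f \+ g.
Definition linmap_opp f : {linear U -> W} := \- f.

Lemma linmap_addA : associative linmap_add.
Proof. by move=> f g h; apply: linmap_ext => x /=; rewrite addrA. Qed.
Lemma linmap_addC : commutative linmap_add.
Proof. by move=> f g; apply: linmap_ext => x /=; rewrite addrC. Qed.
Lemma linmap_add0 : left_id linmap_zero linmap_add.
Proof. by move=> f; apply: linmap_ext => x /=; rewrite add0r. Qed.
Lemma linmap_addN : left_inverse linmap_zero linmap_opp linmap_add.
Proof. by move=> f; apply: linmap_ext => x /=; rewrite addNr. Qed.

HB.instance Definition _ := GRing.isZmodule.Build {linear U -> W}
  linmap_addA linmap_addC linmap_add0 linmap_addN.

Definition linmap_scale_fun (a : K) f : U -> W := fun x => a *: f x.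
Lemma linmap_scale_linear a f : linear (linmap_scale_fun a f).
Proof.
by move=> b x y; rewrite /linmap_scale_fun linearP scalerDr !scalerA mulrC.
Qed.
HB.instance Definition _ a f :=
  GRing.isLinear.Build K U W *:%R (linmap_scale_fun a f)
    (linmap_scale_linear a f).
Definition linmap_scale a f : {linear U -> W} := linmap_scale_fun a f.

Lemma linmap_scaleA a b f :
  linmap_scale a (linmap_scale b f) = linmap_scale (a * b) f.
Proof. by apply: linmap_ext => x; rewrite /= /linmap_scale_fun /= scalerA. Qed.
Lemma linmap_scale1 : left_id 1 linmap_scale.
Proof. by move=> f; apply: linmap_ext => x; rewrite /= /linmap_scale_fun scale1r. Qed.
Lemma linmap_scaleDr : right_distributive linmap_scale +%R.
Proof.
by move=> a f g; apply: linmap_ext => x; rewrite /= /linmap_scale_fun scalerDr.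
Qed.
Lemma linmap_scaleDl f : {morph linmap_scale^~ f : a b / a + b}.
Proof.
by move=> a b; apply: linmap_ext => x; rewrite /= /linmap_scale_fun scalerDl.
Qed.

HB.instance Definition _ := GRing.Zmodule_isLmodule.Build K {linear U -> W}
  linmap_scaleA linmap_scale1 linmap_scaleDr linmap_scaleDl.

Lemma linmap0E x : (0 : {linear U -> W}) x = 0. Proof. by []. Qed.
Lemma linmapDE f g x : (f + g) x = f x + g x. Proof. by []. Qed.
Lemma linmapNE f x : (- f) x = - f x. Proof. by []. Qed.
Lemma linmapZE a f x : (a *: f) x = a *: f x. Proof. by []. Qed.

End LinearMaps.

Section Endomorphisms.
Variables (K : comPzRingType) (U : lmodType K).
Implicit Types f g h : {linear U -> U}.

Definition linend_one : {linear U -> U} := idfun.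
Definition linend_mul f g : {linear U -> U} := f \o g.

Lemma linend_mulA : associative linend_mul.
Proof. by move=> f g h; apply: linmap_ext. Qed.
Lemma linend_mul1 : left_id linend_one linend_mul.
Proof. by move=> f; apply: linmap_ext. Qed.
Lemma linend_mulr1 : right_id linend_one linend_mul.
Proof. by move=> f; apply: linmap_ext. Qed.
Lemma linend_mulDl : left_distributive linend_mul +%R.
Proof. by move=> f g h; apply: linmap_ext. Qed.
Lemma linend_mulDr : right_distributive linend_mul +%R.
Proof. by move=> f g h; apply: linmap_ext => x /=; rewrite linearD. Qed.

HB.instance Definition _ := GRing.Zmodule_isPzRing.Build {linear U -> U}
  linend_mulA linend_mul1 linend_mulr1 linend_mulDl linend_mulDr.

Lemma linend1E x : (1 : {linear U -> U}) x = x. Proof. by []. Qed.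
Lemma linendME f g x : (f * g) x = f (g x). Proof. by []. Qed.

Definition is_subalgebra (A : set {linear U -> U}) :=
  [/\ A 1, forall a f g, A f -> A g -> A (a *: f + g)
    & forall f g, A f -> A g -> A (f * g)].

Definition gen_subalgebra (G : set {linear U -> U}) : set {linear U -> U} :=
  smallest is_subalgebra G.

End Endomorphisms.

Section Quotients.
Variables (K : comPzRingType) (M : lmodType K) (r : set M).

Definition is_submodule (S : set M) :=
  S 0 /\ forall a x y, S x -> S y -> S (a *: x + y).

Definition lspan : set M := smallest is_submodule r.

Lemma lspan_submodule : is_submodule lspan.
Proof.
split=> [S [[S0 _] _]|a x y Sx Sy S [subS rS]] //.
by case: (subS) => _; apply; [apply: Sx|apply: Sy].
Qed.

Definition in_lspan : {pred M} := fun x => `[< lspan x >].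

Lemma in_lspanE x : (x \in in_lspan) = `[< lspan x >]. Proof. by []. Qed.

Lemma in_lspan_zmod_closed : zmod_closed in_lspan.
Proof.
have [S0 SL] := lspan_submodule.
split=> [|x y]; rewrite !in_lspanE; first exact/asboolP.
move=> /asboolP Sx /asboolP Sy; apply/asboolP.
by rewrite addrC -scaleN1r; apply: SL.
Qed.

HB.instance Definition _ :=
  GRing.isZmodClosed.Build M in_lspan in_lspan_zmod_closed.

Definition lquot : Type := Quotient.quot in_lspan.
HB.instance Definition _ := GRing.Zmodule.on lquot.

Definition lquot_pi_fun (x : M) : lquot := (\pi_(Quotient.quot in_lspan) x)%qT.

Lemma lquot_pi_zmod : zmod_morphism lquot_pi_fun.
Proof. by move=> x y; rewrite /lquot_pi_fun !piE. Qed.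

Lemma lquot_pi_eq x y :
  (lquot_pi_fun x = lquot_pi_fun y) <-> lspan (x - y).
Proof.
split=> [/eqP|H]; last apply/eqP; rewrite /lquot_pi_fun piE;
by [move/asboolP|apply/asboolP].
Qed.

Definition lquot_repr (q : lquot) : M :=
  generic_quotient.repr (q : Quotient.quot in_lspan).

Lemma lquot_reprK : cancel lquot_repr lquot_pi_fun.
Proof. exact: reprK. Qed.

Definition lquot_scale (a : K) (q : lquot) : lquot :=
  lquot_pi_fun (a *: lquot_repr q).

Lemma lquot_scale_pi a x :
  lquot_scale a (lquot_pi_fun x) = lquot_pi_fun (a *: x).
Proof.
apply/lquot_pi_eq; rewrite -scalerBr -[_ *: _]addr0.
have [S0 SL] := lspan_submodule; apply: SL => //.
by apply/lquot_pi_eq; rewrite lquot_reprK.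
Qed.

Lemma lquot_scaleA a b q :
  lquot_scale a (lquot_scale b q) = lquot_scale (a * b) q.
Proof. by rewrite -[q]lquot_reprK !lquot_scale_pi scalerA. Qed.
Lemma lquot_scale1 : left_id 1 lquot_scale.
Proof. by move=> q; rewrite -[q]lquot_reprK lquot_scale_pi scale1r. Qed.
Lemma lquot_piD x y :
  lquot_pi_fun (x + y) = lquot_pi_fun x + lquot_pi_fun y.
Proof. by rewrite /lquot_pi_fun !piE. Qed.
Lemma lquot_scaleDr : right_distributive lquot_scale +%R.
Proof.
move=> a q q'; rewrite -[q]lquot_reprK -[q']lquot_reprK -lquot_piD.
by rewrite !lquot_scale_pi scalerDr lquot_piD.
Qed.
Lemma lquot_scaleDl q : {morph lquot_scale^~ q : a b / a + b}.
Proof.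
move=> a b; rewrite -[q]lquot_reprK !lquot_scale_pi scalerDl.
exact: lquot_piD.
Qed.

HB.instance Definition _ := GRing.Zmodule_isLmodule.Build K lquot
  lquot_scaleA lquot_scale1 lquot_scaleDr lquot_scaleDl.

Lemma lquot_pi_linear : linear lquot_pi_fun.
Proof. by move=> a x y; rewrite lquot_piD -lquot_scale_pi. Qed.

HB.instance Definition _ := GRing.isLinear.Build K M lquot *:%R lquot_pi_fun
  lquot_pi_linear.

Definition lquot_pi : {linear M -> lquot} := lquot_pi_fun.

Lemma lquot_pi_rel x y : r (x - y) -> lquot_pi x = lquot_pi y.
Proof. by move=> rxy; apply/lquot_pi_eq => S [_]; apply. Qed.

Lemma lquot_ind (P : lquot -> Prop) :
  (forall x, P (lquot_pi x)) -> forall q, P q.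
Proof. by move=> H q; rewrite -[q]lquot_reprK; apply: H. Qed.

Section Lift.
Variables (W : lmodType K) (f : {linear M -> W}).
Hypothesis fr : forall x, r x -> f x = 0.

Definition lquot_lift_fun (q : lquot) : W := f (lquot_repr q).

Lemma lquot_lift_funE x : lquot_lift_fun (lquot_pi x) = f x.
Proof.
apply/eqP; rewrite -subr_eq0 -linearB; apply/eqP.
have sp : lspan (lquot_repr (lquot_pi x) - x).
  by apply/lquot_pi_eq; rewrite lquot_reprK.
apply: (sp (fun y => f y = 0)); split=> //; split=> [|a y z fy fz]; first by rewrite /= linear0.
by rewrite linearP fy fz scaler0 addr0.
Qed.

Lemma lquot_lift_linear : linear lquot_lift_fun.
Proof.
move=> a; elim/lquot_ind=> x; elim/lquot_ind=> y.
by rewrite -linearP !lquot_lift_funE linearP.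
Qed.

HB.instance Definition _ := GRing.isLinear.Build K lquot W *:%R lquot_lift_fun
  lquot_lift_linear.

Definition lquot_lift : {linear lquot -> W} := lquot_lift_fun.

Lemma lquot_liftE x : lquot_lift (lquot_pi x) = f x.
Proof. exact: lquot_lift_funE. Qed.
End Lift.

End Quotients.

(* {malg K[X]} is used here only as the free K-module on X, with basis the  *)
(* symbols << x >>; in particular {malg K[sinf]} below is K S_oo.           *)
Section FreeModules.
Variables (K : comNzRingType) (X : choiceType) (W : lmodType K) (h : X -> W).

Definition free_lift_fun (g : {malg K[X]}) : W :=
  \sum_(x <- msupp g) g@_x *: h x.

Lemma free_liftEw (d : {fset X}%fset) (g : {malg K[X]}) :
  (msupp g `<=` d)%fset -> free_lift_fun g = \sum_(x <- d) g@_x *: h x.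
Proof.
move=> le; rewrite /free_lift_fun (big_fset_incl _ le) // => x _.
by move=> /mcoeff_outdom ->; rewrite scale0r.
Qed.

Lemma free_lift_linear : linear free_lift_fun.
Proof.
move=> a g1 g2; pose d := (msupp (a *: g1 + g2) `|` msupp g1 `|` msupp g2)%fset.
rewrite !(@free_liftEw d); first last.
- by apply/fsubsetP => x; rewrite !in_fsetU => ->; rewrite ?orbT.
- by apply/fsubsetP => x; rewrite !in_fsetU => ->; rewrite ?orbT.
- by apply/fsubsetP => x; rewrite !in_fsetU => ->; rewrite ?orbT.
rewrite scaler_sumr -big_split /=; apply: eq_bigr => x _.
by rewrite mcoeffD mcoeffZ scalerDl scalerA.
Qed.

HB.instance Definition _ := GRing.isLinear.Build K {malg K[X]} W *:%R
  free_lift_fun free_lift_linear.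

Definition free_lift : {linear {malg K[X]} -> W} := free_lift_fun.

Lemma free_liftE x : free_lift << x >> = h x.
Proof.
by rewrite /= (@free_liftEw [fset x]%fset) ?msuppU_le // big_seq_fset1 mcoeffUU scale1r.
Qed.

End FreeModules.

Lemma free_ext (K : comNzRingType) (X : choiceType) (W : lmodType K)
    (f g : {linear {malg K[X]} -> W}) :
  (forall x, f << x >> = g << x >>) -> f = g.
Proof.
move=> fg; apply: linmap_ext => u; rewrite (monalgE u) !linear_sum.
apply: eq_bigr => x _.
have -> : << u@_x *g x >> = u@_x *: << x >> :> {malg K[X]}.
  by apply/malgP=> k; rewrite mcoeffZ !mcoeffU mulr_natr.
by rewrite !linearZ /= fg.
Qed.

Section TensorPower.
Variables (K : comNzRingType) (V : lmodType K) (p : nat).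
Implicit Types (v : {ffun 'I_p -> V}) (i : 'I_p) (x y : V).

Definition repl v i x : {ffun 'I_p -> V} :=
  [ffun j => if j == i then x else v j].

Inductive tpow_rel : set {malg K[{ffun 'I_p -> V}]} :=
  TpowRel v i (a : K) x y :
    tpow_rel (<< repl v i (a *: x + y) >>
              - (a *: << repl v i x >> + << repl v i y >>)).

(* The factors of V^{(x) p} are labelled by 'I_p: the family v stands for   *)
(* v_p ... v_1 with v_{k+1} = v k.                                          *)
Definition tpow : Type := lquot tpow_rel.
HB.instance Definition _ := GRing.Lmodule.on tpow.

Definition tpure v : tpow := lquot_pi tpow_rel << v >>.

Definition multilinear (W : lmodType K) (f : {ffun 'I_p -> V} -> W) :=
  forall v i (a : K) x y,
    f (repl v i (a *: x + y)) = a *: f (repl v i x) + f (repl v i y).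

Lemma tpure_multilinear : multilinear tpure.
Proof.
move=> v i a x y; rewrite /tpure -linearP; apply: lquot_pi_rel.
exact: TpowRel.
Qed.

Lemma tpow_liftP (W : lmodType K) (f : {ffun 'I_p -> V} -> W) :
  multilinear f -> forall u, tpow_rel u -> free_lift f u = 0.
Proof.
move=> fM _ [v i a x y].
by rewrite linearB [X in _ - X]linearP !free_liftE fM subrr.
Qed.

Definition tpow_lift (W : lmodType K) (f : {ffun 'I_p -> V} -> W)
  (fM : multilinear f) : {linear tpow -> W} := lquot_lift (tpow_liftP fM).

Lemma tpow_liftE (W : lmodType K) (f : {ffun 'I_p -> V} -> W)
  (fM : multilinear f) v : tpow_lift fM (tpure v) = f v.
Proof. by rewrite /tpow_lift /tpure lquot_liftE free_liftE. Qed.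

Lemma tpow_ext (W : lmodType K) (f g : {linear tpow -> W}) :
  (forall v, f (tpure v) = g (tpure v)) -> f = g.
Proof.
move=> fg; apply: linmap_ext => t; elim/lquot_ind: t => t.
have E : (f \o lquot_pi tpow_rel : {linear _ -> _}) = g \o lquot_pi tpow_rel.
  by apply: free_ext => v; exact: fg.
exact: (congr1 (fun h : {linear _ -> _} => h t) E).
Qed.

Definition reidx v (s : 'S_p) : {ffun 'I_p -> V} := [ffun i => v (s i)].

Lemma reidx_repl v i x s : reidx (repl v i x) s = repl (reidx v s) (s^-1%g i) x.
Proof.
by apply/ffunP => j; rewrite !ffunE (can2_eq (permK s) (permKV s)).
Qed.

Lemma tpow_perm_subproof s : multilinear (fun v => tpure (reidx v s)).
Proof. by move=> v i a x y; rewrite !reidx_repl tpure_multilinear. Qed.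

(* v_p ... v_1 s = v_{s(p)} ... v_{s(1)} *)
Definition tpow_perm (s : 'S_p) : {linear tpow -> tpow} :=
  tpow_lift (tpow_perm_subproof s).

Lemma tpow_permE s v : tpow_perm s (tpure v) = tpure (reidx v s).
Proof. exact: tpow_liftE. Qed.

End TensorPower.

Section BalancedTensor.
Variables (K : comNzRingType) (G : Type) (M N : lmodType K).
Variables (ra : G -> {linear M -> M}) (la : G -> {linear N -> N}).

(* M (x)_{KG} N, for M acted on from the right by ra and N from the left by *)
(* la; by linearity, balancing over G is the same as balancing over KG.     *)
Inductive tens_rel : set {malg K[(M * N)%type]} :=
| TensRelL (a : K) m m' n :
    tens_rel (<< (a *: m + m', n) >> - (a *: << (m, n) >> + << (m', n) >>))
| TensRelR (a : K) m n n' :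
    tens_rel (<< (m, a *: n + n') >> - (a *: << (m, n) >> + << (m, n') >>))
| TensRelB g m n : tens_rel (<< (ra g m, n) >> - << (m, la g n) >>).

Definition tens : Type := lquot tens_rel.
HB.instance Definition _ := GRing.Lmodule.on tens.

Definition tensor (m : M) (n : N) : tens := lquot_pi tens_rel << (m, n) >>.

Lemma tensorPl a m m' n :
  tensor (a *: m + m') n = a *: tensor m n + tensor m' n.
Proof. by rewrite /tensor -linearP; apply: lquot_pi_rel; exact: TensRelL. Qed.
Lemma tensorPr a m n n' :
  tensor m (a *: n + n') = a *: tensor m n + tensor m n'.
Proof. by rewrite /tensor -linearP; apply: lquot_pi_rel; exact: TensRelR. Qed.
Lemma tensorB g m n : tensor (ra g m) n = tensor m (la g n).
Proof. by apply: lquot_pi_rel; exact: TensRelB. Qed.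

Section Lift.
Variables (W : lmodType K) (f : {linear M -> {linear N -> W}}).
Hypothesis fB : forall g m n, f (ra g m) n = f m (la g n).

Lemma tens_liftP x : tens_rel x -> free_lift (fun u => f u.1 u.2) x = 0.
Proof.
case=> [a m m' n|a m n n'|g m n];
  rewrite linearB ?[X in _ - X]linearP !free_liftE /=.
- by rewrite (linearP f) linmapDE linmapZE subrr.
- by rewrite (linearP (f m)) subrr.
- by rewrite fB subrr.
Qed.

Definition tens_lift : {linear tens -> W} := lquot_lift tens_liftP.

Lemma tens_liftE m n : tens_lift (tensor m n) = f m n.
Proof. by rewrite /tens_lift /tensor lquot_liftE free_liftE. Qed.
End Lift.

Definition tensor_fun (m : M) := fun n => tensor m n.
Lemma tensor_fun_linear m : linear (tensor_fun m).
Proof. by move=> a n n'; exact: tensorPr. Qed.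
HB.instance Definition _ m :=
  GRing.isLinear.Build K N tens *:%R (tensor_fun m) (tensor_fun_linear m).
Definition tensor_lin1 (m : M) : {linear N -> tens} := tensor_fun m.
Lemma tensor_lin1_linear : linear tensor_lin1.
Proof. by move=> a m m'; apply: linmap_ext => n; exact: tensorPl. Qed.
HB.instance Definition _ :=
  GRing.isLinear.Build K M {linear N -> tens} *:%R tensor_lin1
    tensor_lin1_linear.
Definition tensor_lin : {linear M -> {linear N -> tens}} := tensor_lin1.

Lemma tens_ext (W : lmodType K) (f g : {linear tens -> W}) :
  (forall m n, f (tensor m n) = g (tensor m n)) -> f = g.
Proof.
move=> fg; apply: linmap_ext => t; elim/lquot_ind: t => t.
have E : (f \o lquot_pi tens_rel : {linear _ -> _}) = g \o lquot_pi tens_rel.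
  by apply: free_ext => -[m n]; exact: fg.
exact: (congr1 (fun h : {linear _ -> _} => h t) E).
Qed.

End BalancedTensor.

Section DirectSum.
Variables (K : comNzRingType) (I : choiceType) (M : I -> lmodType K).

Record dsum : Type := Dsum {
  dcoord :> forall i, M i;
  dsum_finite : exists s : seq I, forall i, i \notin s -> dcoord i = 0
}.

HB.instance Definition _ := gen_eqMixin dsum.
HB.instance Definition _ := gen_choiceMixin dsum.

Lemma dsum_ext (x y : dsum) : (forall i, x i = y i) -> x = y.
Proof.
case: x => x Px; case: y => y Py /= xy.
have E : x = y by apply: functional_extensionality_dep.
by case: _ / E Py => Py; congr Dsum; apply: Prop_irrelevance.
Qed.

Definition dsupp (x : dsum) : seq I := undup (sval (cid (dsum_finite x))).

Lemma dsuppP (x : dsum) i : i \notin dsupp x -> x i = 0.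
Proof. by rewrite mem_undup; case: cid => s /= h /h. Qed.

Lemma dsum_zeroP : exists s : seq I, forall i, i \notin s -> 0 = 0 :> M i.
Proof. by exists [::]. Qed.
Definition dsum_zero : dsum := Dsum dsum_zeroP.

Lemma dsum_addP (x y : dsum) :
  exists s : seq I, forall i, i \notin s -> x i + y i = 0.
Proof.
exists (dsupp x ++ dsupp y) => i; rewrite mem_cat negb_or => /andP[ix iy].
by rewrite !dsuppP // addr0.
Qed.
Definition dsum_add (x y : dsum) : dsum := Dsum (dsum_addP x y).

Lemma dsum_oppP (x : dsum) : exists s : seq I, forall i, i \notin s -> - x i = 0.
Proof. by exists (dsupp x) => i ix; rewrite dsuppP // oppr0. Qed.
Definition dsum_opp (x : dsum) : dsum := Dsum (dsum_oppP x).

Lemma dsum_scaleP (a : K) (x : dsum) :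
  exists s : seq I, forall i, i \notin s -> a *: x i = 0.
Proof. by exists (dsupp x) => i ix; rewrite dsuppP // scaler0. Qed.
Definition dsum_scale (a : K) (x : dsum) : dsum := Dsum (dsum_scaleP a x).

Lemma dsum_addA : associative dsum_add.
Proof. by move=> x y z; apply: dsum_ext => i /=; rewrite addrA. Qed.
Lemma dsum_addC : commutative dsum_add.
Proof. by move=> x y; apply: dsum_ext => i /=; rewrite addrC. Qed.
Lemma dsum_add0 : left_id dsum_zero dsum_add.
Proof. by move=> x; apply: dsum_ext => i /=; rewrite add0r. Qed.
Lemma dsum_addN : left_inverse dsum_zero dsum_opp dsum_add.
Proof. by move=> x; apply: dsum_ext => i /=; rewrite addNr. Qed.

HB.instance Definition _ := GRing.isZmodule.Build dsum
  dsum_addA dsum_addC dsum_add0 dsum_addN.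

Lemma dsum_scaleA a b x : dsum_scale a (dsum_scale b x) = dsum_scale (a * b) x.
Proof. by apply: dsum_ext => i /=; rewrite scalerA. Qed.
Lemma dsum_scale1 : left_id 1 dsum_scale.
Proof. by move=> x; apply: dsum_ext => i /=; rewrite scale1r. Qed.
Lemma dsum_scaleDr : right_distributive dsum_scale +%R.
Proof. by move=> a x y; apply: dsum_ext => i /=; rewrite scalerDr. Qed.
Lemma dsum_scaleDl x : {morph dsum_scale^~ x : a b / a + b}.
Proof. by move=> a b; apply: dsum_ext => i /=; rewrite scalerDl. Qed.

HB.instance Definition _ := GRing.Zmodule_isLmodule.Build K dsum
  dsum_scaleA dsum_scale1 dsum_scaleDr dsum_scaleDl.

Lemma dsum0E i : (0 : dsum) i = 0. Proof. by []. Qed.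
Lemma dsumDE (x y : dsum) i : (x + y) i = x i + y i. Proof. by []. Qed.
Lemma dsumZE (a : K) (x : dsum) i : (a *: x) i = a *: x i. Proof. by []. Qed.

Definition dsum_in_coord i (x : M i) j : M j :=
  if i =P j is ReflectT e then ecast k (M k) e x else 0.

Lemma dsum_in_coordE i x : @dsum_in_coord i x i = x.
Proof.
by rewrite /dsum_in_coord; case: eqP => // e; rewrite eq_axiomK.
Qed.

Lemma dsum_in_coordN i x j : i != j -> @dsum_in_coord i x j = 0.
Proof. by rewrite /dsum_in_coord; case: eqP. Qed.

Lemma dsum_inP i x :
  exists s : seq I, forall j, j \notin s -> @dsum_in_coord i x j = 0.
Proof.
by exists [:: i] => j; rewrite inE eq_sym => ij; rewrite dsum_in_coordN.
Qed.

Definition dsum_in_fun i (x : M i) : dsum := Dsum (dsum_inP x).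

Lemma dsum_in_linear i : linear (@dsum_in_fun i).
Proof.
move=> a x y; apply: dsum_ext => j; rewrite dsumDE dsumZE /=.
case: (eqVneq i j) => [{j}<-|ij]; first by rewrite !dsum_in_coordE.
by rewrite !dsum_in_coordN // scaler0 addr0.
Qed.

HB.instance Definition _ i :=
  GRing.isLinear.Build K (M i) dsum *:%R (@dsum_in_fun i) (@dsum_in_linear i).

Definition dsum_in i : {linear M i -> dsum} := @dsum_in_fun i.

Lemma dsum_inE i x : dsum_in i x i = x.
Proof. exact: dsum_in_coordE. Qed.

Lemma dsum_inN i x j : i != j -> dsum_in i x j = 0.
Proof. exact: dsum_in_coordN. Qed.

Section Lift.
Variables (W : lmodType K) (f : forall i, {linear M i -> W}).

Definition dsum_lift_fun (x : dsum) : W := \sum_(i <- dsupp x) f i (x i).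

Lemma dsum_liftEw (s : seq I) (x : dsum) :
  uniq s -> (forall i, i \notin s -> x i = 0) ->
  dsum_lift_fun x = \sum_(i <- s) f i (x i).
Proof.
move=> us sP; rewrite /dsum_lift_fun.
have ux : uniq (dsupp x) by exact: undup_uniq.
rewrite (bigID (mem s)) /= [X in _ + X]big1 ?addr0; last first.
  by move=> i /sP ->; rewrite linear0.
rewrite [RHS](bigID (mem (dsupp x))) /= [X in _ = _ + X]big1 ?addr0; last first.
  by move=> i /dsuppP ->; rewrite linear0.
rewrite -big_filter -[RHS]big_filter; apply: perm_big.
apply: uniq_perm; rewrite ?filter_uniq // => i.
by rewrite !mem_filter andbC.
Qed.

Lemma dsum_lift_linear : linear dsum_lift_fun.
Proof.
move=> a x y; pose s := undup (dsupp x ++ dsupp y).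
have us : uniq s by exact: undup_uniq.
have sx i : i \notin s -> x i = 0.
  by rewrite mem_undup mem_cat negb_or => /andP[/dsuppP].
have sy i : i \notin s -> y i = 0.
  by rewrite mem_undup mem_cat negb_or => /andP[_ /dsuppP].
have sxy i : i \notin s -> (a *: x + y) i = 0.
  by move=> si; rewrite dsumDE dsumZE sx // sy // scaler0 addr0.
rewrite (dsum_liftEw us sx) (dsum_liftEw us sy) (dsum_liftEw us sxy).
rewrite scaler_sumr -big_split /=; apply: eq_bigr => i _.
exact: linearP.
Qed.

HB.instance Definition _ :=
  GRing.isLinear.Build K dsum W *:%R dsum_lift_fun dsum_lift_linear.

Definition dsum_lift : {linear dsum -> W} := dsum_lift_fun.

Lemma dsum_liftE i x : dsum_lift (dsum_in i x) = f i x.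
Proof.
rewrite /= (@dsum_liftEw [:: i]) ?big_seq1 ?dsum_inE // => j.
by rewrite inE eq_sym; exact: dsum_inN.
Qed.
End Lift.

End DirectSum.

(* The inductive limit of the S_n: permutations of nat fixing all but       *)
(* finitely many points. The natural number k stands for the letter k+1.    *)
Record sinf : Type := SInf {
  sinf_fun :> nat -> nat;
  sinf_inv_fun : nat -> nat;
  sinf_funK : cancel sinf_fun sinf_inv_fun;
  sinf_inv_funK : cancel sinf_inv_fun sinf_fun;
  sinf_finite : exists n, forall k, (n <= k)%N -> sinf_fun k = k
}.

HB.instance Definition _ := gen_eqMixin sinf.
HB.instance Definition _ := gen_choiceMixin sinf.

Lemma sinf_ext (s t : sinf) : (forall k, s k = t k) -> s = t.
Proof.
case: s => s s' sK s'K Ps; case: t => t t' tK t'K Pt /= st.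
have E : s = t by apply/funext.
case: _ / E tK t'K Pt {st} => tK t'K Pt.
have E' : s' = t' by apply/funext => k; rewrite -{2}[k]s'K tK.
case: _ / E' tK t'K => tK t'K.
by congr SInf; apply: Prop_irrelevance.
Qed.

Lemma sinf_one_finite : exists n, forall k, (n <= k)%N -> id k = k.
Proof. by exists 0%N. Qed.
Definition sinf_one : sinf :=
  SInf (fun=> erefl) (fun=> erefl) sinf_one_finite.

Lemma sinf_mul_finite (s t : sinf) :
  exists n, forall k, (n <= k)%N -> s (t k) = k.
Proof.
have [m sm] := sinf_finite s; have [n tn] := sinf_finite t.
by exists (maxn m n) => k; rewrite geq_max => /andP[mk nk]; rewrite tn ?sm.
Qed.
Definition sinf_mul (s t : sinf) : sinf :=
  SInf (can_comp (sinf_funK s) (sinf_funK t))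
       (can_comp (sinf_inv_funK t) (sinf_inv_funK s)) (sinf_mul_finite s t).

Lemma sinf_inv_finite (s : sinf) :
  exists n, forall k, (n <= k)%N -> sinf_inv_fun s k = k.
Proof.
by have [n sn] := sinf_finite s; exists n => k /sn {1}<-; rewrite sinf_funK.
Qed.
Definition sinf_inv (s : sinf) : sinf :=
  SInf (sinf_inv_funK s) (sinf_funK s) (sinf_inv_finite s).

Lemma sinf_mulA : associative sinf_mul.
Proof. by move=> s t u; apply: sinf_ext. Qed.
Lemma sinf_mul1 : left_id sinf_one sinf_mul.
Proof. by move=> s; apply: sinf_ext. Qed.
Lemma sinf_mulr1 : right_id sinf_one sinf_mul.
Proof. by move=> s; apply: sinf_ext. Qed.
Lemma sinf_mulV : left_inverse sinf_one sinf_inv sinf_mul.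
Proof. by move=> s; apply: sinf_ext => k; exact: sinf_funK. Qed.
Lemma sinf_mulrV : right_inverse sinf_one sinf_inv sinf_mul.
Proof. by move=> s; apply: sinf_ext => k; exact: sinf_inv_funK. Qed.

(* Composition of functions: (s * t) k = s (t k), in contrast to {perm _}.  *)
HB.instance Definition _ := isGroup.Build sinf
  sinf_mulA sinf_mul1 sinf_mulr1 sinf_mulV sinf_mulrV.

Lemma sinf1E k : (1%g : sinf) k = k. Proof. by []. Qed.
Lemma sinfME (s t : sinf) k : (s * t)%g k = s (t k). Proof. by []. Qed.

Section SInfOfPerm.
Variable p : nat.
Implicit Type s : 'S_p.

Definition perm_ext s (k : nat) : nat :=
  if insub k is Some i then s i : 'I_p else k.

Lemma perm_ext_ord s (i : 'I_p) : perm_ext s i = s i.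
Proof. by rewrite /perm_ext valK. Qed.

Lemma perm_ext_ge s k : (p <= k)%N -> perm_ext s k = k.
Proof. by move=> pk; rewrite /perm_ext insubF // ltnNge pk. Qed.

Lemma perm_extK s : cancel (perm_ext s) (perm_ext s^-1).
Proof.
move=> k; have [kp|pk] := ltnP k p; last by rewrite !perm_ext_ge.
by rewrite (perm_ext_ord s (Ordinal kp)) perm_ext_ord permK.
Qed.

Lemma perm_extVK s : cancel (perm_ext s^-1) (perm_ext s).
Proof. by have := perm_extK s^-1; rewrite invgK. Qed.

Lemma perm_ext_finite s : exists n, forall k, (n <= k)%N -> perm_ext s k = k.
Proof. by exists p => k; exact: perm_ext_ge. Qed.

Definition sinf_perm s : sinf :=
  SInf (perm_extK s) (perm_extVK s) (perm_ext_finite s).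

Lemma sinf_perm_ord s (i : 'I_p) : sinf_perm s i = s i.
Proof. exact: perm_ext_ord. Qed.

Lemma sinf_perm_ge s k : (p <= k)%N -> sinf_perm s k = k.
Proof. exact: perm_ext_ge. Qed.

End SInfOfPerm.

Definition shift_fun (f : nat -> nat) (k : nat) : nat :=
  if k is k'.+1 then (f k').+1 else 0%N.

Lemma shift_funK (f g : nat -> nat) :
  cancel f g -> cancel (shift_fun f) (shift_fun g).
Proof. by move=> fK [|k] //=; rewrite fK. Qed.

Lemma shift_fun_finite (s : sinf) :
  exists n, forall k, (n <= k)%N -> shift_fun s k = k.
Proof.
have [n sn] := sinf_finite s; exists n.+1 => -[|k] //=; rewrite ltnS.
by move/sn => ->.
Qed.

(* The letter 1 is the number 0: alpha s 0 = 0 and alpha s k.+1 = (s k).+1. *)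
Definition alpha (s : sinf) : sinf :=
  SInf (shift_funK (sinf_funK s)) (shift_funK (sinf_inv_funK s))
       (shift_fun_finite s).

Lemma iter_alphaE p s k :
  iter p alpha s k = if (k < p)%N then k else (s (k - p) + p)%N.
Proof.
elim: p k => [|p IH] [|k] //=; rewrite ?subn0 ?addn0 //.
by rewrite IH ltnS subSS; case: ifP => // _; rewrite addnS.
Qed.

Lemma iter_alphaM p s t :
  iter p alpha (s * t)%g = (iter p alpha s * iter p alpha t)%g.
Proof.
apply: sinf_ext => k; rewrite sinfME !iter_alphaE.
by case: (ltnP k p) => kp; [rewrite kp|rewrite ltnNge leq_addl /= addnK].
Qed.

Lemma iter_alpha_comm p s (t : 'S_p) :
  (iter p alpha s * sinf_perm t = sinf_perm t * iter p alpha s)%g.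
Proof.
apply: sinf_ext => k; rewrite !sinfME !iter_alphaE.
have [kp|pk] := ltnP k p.
  by rewrite (sinf_perm_ord t (Ordinal kp)) ltn_ord.
by rewrite !sinf_perm_ge ?leq_addl // ltnNge pk.
Qed.

Lemma sinf_permM p (s t : 'S_p) :
  sinf_perm (s * t)%g = (sinf_perm t * sinf_perm s)%g.
Proof.
apply: sinf_ext => k; rewrite sinfME.
have [kp|pk] := ltnP k p; last by rewrite !sinf_perm_ge.
by rewrite !(sinf_perm_ord _ (Ordinal kp)) sinf_perm_ord permM.
Qed.

Lemma sinf_perm_lift p (s : 'S_p) :
  sinf_perm (lift_perm ord_max ord_max s) = sinf_perm s.
Proof.
apply: sinf_ext => k; have [kp|pk] := ltnP k p.
  have -> : k = lift ord_max (Ordinal kp) :> nat by rewrite lift_max.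
  by rewrite sinf_perm_ord lift_perm_lift !lift_max sinf_perm_ord.
rewrite [RHS]sinf_perm_ge //; have [->|kp] := eqVneq k p.
  by rewrite (sinf_perm_ord _ ord_max) lift_perm_id.
by rewrite sinf_perm_ge // ltn_neqAle eq_sym kp.
Qed.

Lemma lift_perm_ex p (s : 'S_p.+1) k :
  exists s' : 'S_p, s = lift_perm k (s k) s'.
Proof.
have nk l : s k != s (lift k l) by rewrite (inj_eq perm_inj) neq_lift.
pose f i := odflt i (unlift (s k) (s (lift k i))).
have fE i : s (lift k i) = lift (s k) (f i).
  by rewrite /f; have [j sj ->] := unlift_some (nk i).
have fI : injective f.
  move=> i j fij; apply: (@lift_inj _ k); apply: (@perm_inj _ s).
  by rewrite !fE fij.
exists (perm fI); apply/permP => i.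
case: (unliftP k i) => [j|] ->; last by rewrite lift_perm_id.
by rewrite lift_perm_lift permE fE.
Qed.

(* The cycle m |-> m-1 |-> ... |-> k |-> m, see cycE; lift_perm k ord_max 1 *)
(* sends k to m and is increasing elsewhere.                                *)
Definition cyc m (k : 'I_m.+1) : sinf :=
  sinf_perm (lift_perm k ord_max 1%g).

Lemma cycE m (k : 'I_m.+1) j :
  cyc k j = if j == k then m else if (k < j <= m)%N then j.-1 else j.
Proof.
have [jm|mj] := ltnP j m.+1; last first.
  rewrite sinf_perm_ge // gtn_eqF ?(leq_trans _ mj) //.
  by rewrite [(j <= m)%N]leqNgt mj andbF.
have jm' : (j <= m)%N := jm.
rewrite (sinf_perm_ord _ (Ordinal jm)) jm' andbT.
case: (unliftP k (Ordinal jm)) => [i|] ij.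
  rewrite ij lift_perm_lift perm1 lift_max.
  have -> : j = bump k i by rewrite -[j]/(val (Ordinal jm)) ij.
  rewrite /bump; case: (leqP k i) => ki; rewrite ?add1n ?add0n /=.
    by rewrite gtn_eqF // ltnS ki.
  by rewrite ltn_eqF // ltnNge (ltnW ki).
by rewrite ij lift_perm_id -[j]/(val (Ordinal jm)) ij eqxx.
Qed.

Section BlockPerm.
Variables (p' p : nat) (s' : 'S_p') (s : 'S_p).

Definition block_fun (i : 'I_(p' + p)) : 'I_(p' + p) :=
  match split i with
  | inl j => lshift p (s' j)
  | inr j => rshift p' (s j)
  end.

Lemma block_fun_inj : injective block_fun.
Proof.
move=> i j; rewrite /block_fun.
case: (splitP i) => i' ii'; case: (splitP j) => j' jj' /eqP;
  rewrite ?eq_lshift ?eq_rshift ?eq_lrshift ?eq_rlshift // => /eqP/perm_inj ij;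
  by apply: val_inj; rewrite /= ii' jj' ij.
Qed.

Definition block_perm : 'S_(p' + p) := perm block_fun_inj.

Lemma sinf_block_perm :
  sinf_perm block_perm = (iter p' alpha (sinf_perm s) * sinf_perm s')%g.
Proof.
apply: sinf_ext => k; rewrite sinfME iter_alphaE.
have [kpp|ppk] := ltnP k (p' + p); last first.
  have pk : (p' <= k)%N by apply: leq_trans ppk; rewrite leq_addr.
  rewrite !sinf_perm_ge //; first by rewrite ltnNge pk /= subnK.
  by rewrite leq_subRL.
rewrite (sinf_perm_ord _ (Ordinal kpp)) permE /block_fun.
case: splitP => j kj; [have {}kj : k = j := kj|have {}kj : k = (p' + j)%N := kj].
  by rewrite kj sinf_perm_ord ltn_ord.
rewrite kj (sinf_perm_ge s') ?leq_addr // ltnNge leq_addr addKn.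
by rewrite sinf_perm_ord; exact: addnC.
Qed.

End BlockPerm.

Section Translations.
Variable K : comNzRingType.

Definition ltrans (s : sinf) : {linear {malg K[sinf]} -> {malg K[sinf]}} :=
  free_lift (fun t => << (s * t)%g >>).
Definition rtrans (s : sinf) : {linear {malg K[sinf]} -> {malg K[sinf]}} :=
  free_lift (fun t => << (t * s)%g >>).

End Translations.

Section Tbar.
Variables (K : comNzRingType) (V : lmodType K).

(* V^{(x) p} (x)_{K S_p} K S_oo *)
Definition Tp (p : nat) : Type :=
  tens (@tpow_perm K V p) (fun s => ltrans K (sinf_perm s)).
HB.instance Definition _ p := GRing.Lmodule.on (Tp p).

(* v_p ... v_1 sigma, where v_{k+1} = v k *)
Definition Tpure p (v : {ffun 'I_p -> V}) (s : sinf) : Tp p :=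
  tensor _ _ (tpure v) << s >>.

Lemma Tpure_multilinear p s : multilinear (fun v => @Tpure p v s).
Proof.
by move=> v i a x y; rewrite /Tpure tpure_multilinear; exact: tensorPl.
Qed.

Lemma Tpure_reidx p (v : {ffun 'I_p -> V}) s t :
  Tpure (reidx v s) t = Tpure v (sinf_perm s * t)%g.
Proof.
by rewrite /Tpure -tpow_permE tensorB; congr tensor; exact: free_liftE.
Qed.

Lemma Tp_ext p (W : lmodType K) (f g : {linear Tp p -> W}) :
  (forall v s, f (Tpure v s) = g (Tpure v s)) -> f = g.
Proof.
move=> fg; apply: tens_ext => m n.
set T := tensor_lin (@tpow_perm K V p) (fun s => ltrans K (sinf_perm s)).
have E n' m' : f (T m' << n' >>) = g (T m' << n' >>).
  pose h (k : {linear Tp p -> W}) m := k (T m << n' >>).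
  have hlin k : linear (h k).
    by move=> a x y; rewrite /h linearP linmapDE linmapZE linearP.
  pose hL k : {linear tpow V p -> W} :=
    HB.pack (h k) (GRing.isLinear.Build _ _ _ _ _ (hlin k)).
  have : hL f = hL g by apply: tpow_ext => v; exact: fg.
  by move/(congr1 (fun k : {linear _ -> _} => k m')).
have : (f \o T m : {linear _ -> _}) = g \o T m by apply: free_ext => s; exact: E.
by move/(congr1 (fun k : {linear _ -> _} => k n)).
Qed.

Section Lift.
Variables (p : nat) (W : lmodType K) (h : {ffun 'I_p -> V} -> sinf -> W).
Hypothesis hM : forall s, multilinear (h^~ s).
Hypothesis hB : forall v s t, h (reidx v s) t = h v (sinf_perm s * t)%g.

Definition Tp_lift1 (v : {ffun 'I_p -> V}) : {linear {malg K[sinf]} -> W} :=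
  free_lift (h v).

Lemma Tp_lift1_multilinear : multilinear Tp_lift1.
Proof.
move=> v i a x y; apply: free_ext => s.
by rewrite linmapDE linmapZE !free_liftE hM.
Qed.

Definition Tp_lift2 := tpow_lift Tp_lift1_multilinear.

Lemma Tp_lift2_balanced s m n :
  Tp_lift2 (@tpow_perm K V p s m) n = Tp_lift2 m (ltrans K (sinf_perm s) n).
Proof.
pose F m : {linear {malg K[sinf]} -> W} := Tp_lift2 m \o ltrans K (sinf_perm s).
have Flin : linear F.
  move=> a x y; apply: linmap_ext => t.
  rewrite /F; have -> : Tp_lift2 (a *: x + y) = a *: Tp_lift2 x + Tp_lift2 y.
    exact: linearP.
  by [].
pose FL : {linear tpow V p -> {linear {malg K[sinf]} -> W}} :=
  HB.pack F (GRing.isLinear.Build _ _ _ _ _ Flin).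
have E : (Tp_lift2 \o @tpow_perm K V p s : {linear _ -> _}) = FL.
  apply: tpow_ext => v; apply: free_ext => t.
  change (Tp_lift2 (@tpow_perm K V p s (tpure v)) << t >>
        = Tp_lift2 (tpure v) (ltrans K (sinf_perm s) << t >>)).
  by rewrite tpow_permE /Tp_lift2 !tpow_liftE !free_liftE hB.
exact: (congr1 (fun k : {linear tpow V p -> {linear _ -> _}} => k m n) E).
Qed.

Definition Tp_lift : {linear Tp p -> W} := tens_lift Tp_lift2_balanced.

Lemma Tp_liftE v s : Tp_lift (Tpure v s) = h v s.
Proof.
by rewrite /Tp_lift /Tpure tens_liftE /Tp_lift2 tpow_liftE free_liftE.
Qed.
End Lift.

Definition Tbar : Type := dsum (fun p : nat => Tp p : lmodType K).
HB.instance Definition _ := GRing.Lmodule.on Tbar.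

Definition Tin (p : nat) : {linear Tp p -> Tbar} :=
  @dsum_in K nat (fun p => Tp p : lmodType K) p.

Definition Tbar_lift (W : lmodType K) (f : forall p, {linear Tp p -> W}) :
  {linear Tbar -> W} := @dsum_lift K nat (fun p => Tp p : lmodType K) W f.

Lemma Tbar_liftE (W : lmodType K) (f : forall p, {linear Tp p -> W}) p x :
  Tbar_lift f (Tin p x) = f p x.
Proof. exact: dsum_liftE. Qed.

Lemma eq_Tbar_lift (W : lmodType K) (f g : forall p, {linear Tp p -> W}) :
  (forall p, f p = g p) -> Tbar_lift f = Tbar_lift g.
Proof.
move=> fg; apply: linmap_ext => x.
by apply: eq_bigr => p _; rewrite fg.
Qed.

Lemma Tp_act_multilinear p s t : multilinear (fun v => @Tpure p v (t * s)%g).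
Proof. exact: Tpure_multilinear. Qed.
Lemma Tp_act_balanced s p (v : {ffun 'I_p -> V}) r t :
  Tpure (reidx v r) (t * s)%g = Tpure v (sinf_perm r * t * s)%g.
Proof. by rewrite Tpure_reidx mulgA. Qed.
Definition Tp_act p (s : sinf) : {linear Tp p -> Tp p} :=
  Tp_lift (@Tp_act_multilinear p s) (Tp_act_balanced s (p := p)).

Definition Tbar_act (s : sinf) : {linear Tbar -> Tbar} :=
  Tbar_lift (fun p => Tin p \o Tp_act p s).

(* the family v_p ... v_1 v'_p' ... v'_1 *)
Definition fcat p p' (v : {ffun 'I_p -> V}) (v' : {ffun 'I_p' -> V}) :
  {ffun 'I_(p' + p) -> V} :=
  [ffun i => match split i with inl j => v' j | inr j => v j end].

Lemma fcat_repl_l p p' (v : {ffun 'I_p -> V}) (v' : {ffun 'I_p' -> V}) i x :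
  fcat (repl v i x) v' = repl (fcat v v') (rshift p' i) x.
Proof.
apply/ffunP => k; rewrite !ffunE.
by case: split_ordP => j ->; rewrite ?ffunE ?eq_lrshift ?eq_rshift.
Qed.

Lemma fcat_repl_r p p' (v : {ffun 'I_p -> V}) (v' : {ffun 'I_p' -> V}) i x :
  fcat v (repl v' i x) = repl (fcat v v') (lshift p i) x.
Proof.
apply/ffunP => k; rewrite !ffunE.
by case: split_ordP => j ->; rewrite ?ffunE ?eq_rlshift ?eq_lshift.
Qed.

Lemma fcat_reidx p p' (v : {ffun 'I_p -> V}) (v' : {ffun 'I_p' -> V}) s s' :
  fcat (reidx v s) (reidx v' s') = reidx (fcat v v') (block_perm s' s).
Proof.
apply/ffunP => k; rewrite !ffunE permE /block_fun.
case: (split_ordP k) => j _; rewrite ffunE.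
  by rewrite (unsplitK (inl (s' j))).
by rewrite (unsplitK (inr (s j))).
Qed.

Lemma reidx1 p (v : {ffun 'I_p -> V}) : reidx v 1%g = v.
Proof. by apply/ffunP => k; rewrite ffunE perm1. Qed.

Lemma sinf_perm1 p : sinf_perm (1%g : 'S_p) = 1%g.
Proof.
apply: sinf_ext => k; have [kp|pk] := ltnP k p; last by rewrite sinf_perm_ge.
by rewrite (sinf_perm_ord _ (Ordinal kp)) perm1.
Qed.

Section Product.
Variables (p p' : nat).

Definition Tmul_pure (v : {ffun 'I_p -> V}) (s : sinf)
    (v' : {ffun 'I_p' -> V}) (s' : sinf) : Tbar :=
  Tin (p' + p) (Tpure (fcat v v') (iter p' alpha s * s')%g).

Lemma Tmul_pure_reidx v s v' s' r r' :
  Tmul_pure (reidx v r) s (reidx v' r') s'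
  = Tmul_pure v (sinf_perm r * s)%g v' (sinf_perm r' * s')%g.
Proof.
rewrite /Tmul_pure fcat_reidx Tpure_reidx sinf_block_perm iter_alphaM.
congr (Tin _ (Tpure _ _)); rewrite -!mulgA; congr (_ * _)%g.
by rewrite !mulgA iter_alpha_comm.
Qed.

Lemma Tmul_pure_multilinear_r v s s' :
  multilinear (fun v' => Tmul_pure v s v' s').
Proof.
by move=> v' i a x y; rewrite /Tmul_pure !fcat_repl_r Tpure_multilinear linearP.
Qed.

Lemma Tmul_pure_balanced_r v s v' r' s' :
  Tmul_pure v s (reidx v' r') s' = Tmul_pure v s v' (sinf_perm r' * s')%g.
Proof.
have := Tmul_pure_reidx v s v' s' 1 r'.
by rewrite reidx1 sinf_perm1 mul1g.
Qed.

Definition Tmul_r v s : {linear Tp p' -> Tbar} :=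
  Tp_lift (Tmul_pure_multilinear_r v s) (Tmul_pure_balanced_r v s).

Lemma Tmul_r_multilinear s : multilinear (fun v => Tmul_r v s).
Proof.
move=> v i a x y; apply: Tp_ext => v' s'.
rewrite linmapDE linmapZE !Tp_liftE /Tmul_pure !fcat_repl_l.
by rewrite Tpure_multilinear linearP.
Qed.

Lemma Tmul_r_balanced v r s :
  Tmul_r (reidx v r) s = Tmul_r v (sinf_perm r * s)%g.
Proof.
apply: Tp_ext => v' s'; rewrite !Tp_liftE.
have := Tmul_pure_reidx v s v' s' r 1.
by rewrite reidx1 sinf_perm1 mul1g.
Qed.

End Product.

Definition Tmul_l p (v : {ffun 'I_p -> V}) (s : sinf) : {linear Tbar -> Tbar} :=
  Tbar_lift (fun p' => Tmul_r p' v s).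

Lemma Tmul_l_multilinear p s : multilinear (fun v => @Tmul_l p v s).
Proof.
move=> v i a x y; rewrite /Tmul_l (eq_Tbar_lift (g := fun p' =>
  a *: Tmul_r p' (repl v i x) s + Tmul_r p' (repl v i y) s)); last first.
  by move=> p'; exact: Tmul_r_multilinear.
apply: linmap_ext => t; rewrite linmapDE linmapZE.
by rewrite /= /dsum_lift_fun scaler_sumr -big_split.
Qed.

Lemma Tmul_l_balanced p (v : {ffun 'I_p -> V}) r s :
  Tmul_l (reidx v r) s = Tmul_l v (sinf_perm r * s)%g.
Proof. by apply: eq_Tbar_lift => p'; exact: Tmul_r_balanced. Qed.

Definition Tmul : {linear Tbar -> {linear Tbar -> Tbar}} :=
  Tbar_lift (fun p => Tp_lift (@Tmul_l_multilinear p) (@Tmul_l_balanced p)).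

Lemma TmulE p p' (v : {ffun 'I_p -> V}) s (v' : {ffun 'I_p' -> V}) s' :
  Tmul (Tin p (Tpure v s)) (Tin p' (Tpure v' s'))
  = Tin (p' + p) (Tpure (fcat v v') (iter p' alpha s * s')%g).
Proof. by rewrite Tbar_liftE Tp_liftE Tbar_liftE Tp_liftE. Qed.

Definition Lop (phi : Tbar) : {linear Tbar -> Tbar} := Tmul phi.

Definition Lvec (v : V) : {linear Tbar -> Tbar} :=
  Lop (Tin 1 (Tpure [ffun=> v] 1%g)).

(* [ffun=> 0] is the empty family: its index type is 'I_0. *)
Definition Lperm (s : sinf) : {linear Tbar -> Tbar} :=
  Lop (Tin 0 (Tpure [ffun=> 0] s)).

Section Annihilation.
Variable phi : {linear V -> K^o}.

Definition fdel p (v : {ffun 'I_p.+1 -> V}) (k : 'I_p.+1) : {ffun 'I_p -> V} :=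
  [ffun i => v (lift k i)].

Definition Lann_pure p (v : {ffun 'I_p.+1 -> V}) (t : sinf) : Tp p :=
  \sum_(k < p.+1) phi (v k) *: Tpure (fdel v k) (cyc k * t)%g.

Lemma Lann_multilinear p t : multilinear (fun v => @Lann_pure p v t).
Proof.
move=> v i a x y; rewrite /Lann_pure scaler_sumr -big_split /=.
apply: eq_bigr => k _; rewrite !ffunE.
have [->|ki] := eqVneq k i.
  have E z : fdel (repl v i z) i = fdel v i.
    by apply/ffunP => j; rewrite !ffunE eq_sym (negbTE (neq_lift _ _)).
  by rewrite !E linearP scalerDl scalerA.
have [j ij|] := unliftP k i; last by move/esym/eqP; rewrite (negbTE ki).
have E z : fdel (repl v i z) k = repl (fdel v k) j z.
  by apply/ffunP => l; rewrite !ffunE ij (inj_eq lift_inj).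
by rewrite !E Tpure_multilinear scalerDr !scalerA mulrC.
Qed.

Lemma Lann_balanced p (v : {ffun 'I_p.+1 -> V}) s t :
  Lann_pure (reidx v s) t = Lann_pure v (sinf_perm s * t)%g.
Proof.
rewrite /Lann_pure [RHS](reindex_inj (@perm_inj _ s)) /=.
apply: eq_bigr => k _; rewrite ffunE.
have [s' es] := lift_perm_ex s k.
have -> : fdel (reidx v s) k = reidx (fdel v (s k)) s'.
  by apply/ffunP => i; rewrite !ffunE {1}es lift_perm_lift.
have E : (sinf_perm s' * cyc k = cyc (s k) * sinf_perm s)%g.
  rewrite /cyc -sinf_permM -(sinf_perm_lift s') -sinf_permM.
  by rewrite lift_permM {1}es lift_permM mul1g mulg1.
by rewrite Tpure_reidx !mulgA E.
Qed.

Definition Lann_S p : {linear Tp p.+1 -> Tp p} :=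
  Tp_lift (@Lann_multilinear p) (@Lann_balanced p).

Definition Lann_p p : {linear Tp p -> Tbar} :=
  match p with
  | 0%N => 0
  | p.+1 => Tin p \o Lann_S p
  end.

Definition Lann : {linear Tbar -> Tbar} := Tbar_lift Lann_p.

Lemma Lann0E v t : Lann (Tin 0 (Tpure v t)) = 0.
Proof. by rewrite Tbar_liftE. Qed.

Lemma LannE p (v : {ffun 'I_p.+1 -> V}) t :
  Lann (Tin p.+1 (Tpure v t))
  = \sum_(k < p.+1) phi (v k) *: Tin p (Tpure (fdel v k) (cyc k * t)%g).
Proof.
rewrite Tbar_liftE.
have -> : Lann_p p.+1 (Tpure v t) = Tin p (Lann_pure v t).
  by rewrite -(Tp_liftE (@Lann_multilinear p) (@Lann_balanced p)).
rewrite linear_sum; apply: eq_bigr => k _; exact: linearZ.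
Qed.

End Annihilation.
End Tbar.

Section Operators.
Variables (K : fieldType) (V : vectType K).

Definition dual := 'Hom(V, K^o).

Definition Ldual (w : dual) : {linear Tbar V -> Tbar V} := Lann w.

Definition calL : set {linear Tbar V -> Tbar V} :=
  gen_subalgebra (range (@Lvec K V) `|` range Ldual `|` range (@Lperm K V)).

(* L(v_p) ... L(v_1) L(sigma) L(v_1^* ) ... L(v_q^* ), where v_{i+1} = v i *)
Definition Lword p q (v : {ffun 'I_p -> V}) (s : sinf)
    (w : {ffun 'I_q -> dual}) : {linear Tbar V -> Tbar V} :=
  (\prod_(i < p) Lvec (v (rev_ord i))) * Lperm V s * \prod_(j < q) Ldual (w j).

(* sigma w_1 ... w_q is obtained by reindexing along sigma^-1. *)
Definition dual_act q (s : 'S_q) : {linear tpow dual q -> tpow dual q} :=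
  tpow_perm dual s^-1%g.

(* V^{(x) p} (x)_{K S_p} K S_oo (x)_{K S_q} V^*^{(x) q} *)
Definition Tpq (p q : nat) : Type :=
  tens (fun s : 'S_q => Tp_act V p (sinf_perm s)) (@dual_act q).
HB.instance Definition _ p q := GRing.Lmodule.on (Tpq p q).

Definition Tdouble : Type :=
  dsum (fun pq : nat * nat => Tpq pq.1 pq.2 : lmodType K).
HB.instance Definition _ := GRing.Lmodule.on Tdouble.

Definition Tdouble_pure p q (v : {ffun 'I_p -> V}) (s : sinf)
    (w : {ffun 'I_q -> dual}) : Tdouble :=
  dsum_in (fun pq : nat * nat => Tpq pq.1 pq.2 : lmodType K) (p, q)
    (tensor _ _ (Tpure v s) (tpure w)).

(* Tbar(V) (x)_{K S_q} V^*^{(x) q} *)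
Definition Tbarq (q : nat) : Type :=
  tens (fun s : 'S_q => Tbar_act V (sinf_perm s)) (@dual_act q).
HB.instance Definition _ q := GRing.Lmodule.on (Tbarq q).

Definition Tsingle : Type := dsum (fun q : nat => Tbarq q : lmodType K).
HB.instance Definition _ := GRing.Lmodule.on Tsingle.

Definition Tsingle_pure p q (v : {ffun 'I_p -> V}) (s : sinf)
    (w : {ffun 'I_q -> dual}) : Tsingle :=
  dsum_in (fun q : nat => Tbarq q : lmodType K) q
    (tensor _ _ (Tin V p (Tpure v s)) (tpure w)).
End Operators.

Arguments calL {K} V _.

(* Main.v *)
From HB Require Import structures.
Require Import Defs.
From mathcomp Require Import all_boot all_order fingroup perm all_algebra.
From mathcomp Require Import boolp classical_sets reals complex.

Set Implicit Arguments.
Unset Strict Implicit.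
Unset Printing Implicit Defensive.

Import GRing.Theory.
Local Open Scope ring_scope.
Local Open Scope classical_set_scope.
Local Open Scope complex_scope.

(**
The operators satisfy commutation relations that let every product be brought
into normal order, vectors to the left, then a permutation, then covectors.
Write s for the transposition of the letters 1 and 2. Then
  L(sigma) L(v) = L(v) L(alpha sigma),
  L(v^* ) L(sigma) = L(alpha sigma) L(v^* ),
  L(v^* ) L(v) = <v^*, v> + L(v) L(s) L(v^* ),
  L(v^* ) L(w^* ) = L(s) L(w^* ) L(v^* )
([opS_opV], [opA_opS], [opA_opV], [opA_opA]). The first and the third follow
from the formulas on monomials. The other two then follow by induction on the
degree, since the operators L(v) generate Tbar(V) from degree 0; for the last
one the inductive step is the braid relation between s and alpha s.

The last relation says that alpha^i s, placed to the left of
L(v_1^* ) ... L(v_q^* ), exchanges two neighbouring factors. Adjacent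
transpositions generate S_q, so x (x) v_1^* ... v_q^* |-> L(x) L(v_1^* ) ...
L(v_q^* ) is balanced over S_q and defines a linear map Psi on the direct sum
of the Tbar(V) (x)_{S_q} V^*^{(x) q} ([exchange_perm], [Psi]). The isomorphism
theta with the double direct sum is inverted by an explicit map defined on
monomials ([thetaK], [etaK]), and Phi is Psi o theta.

The image of Psi contains 1 and, by the commutation relations, is stable under
left multiplication by each generator, hence by all of the algebra they
generate; so it is that algebra ([range_Psi]).

For injectivity, let e_1, ..., e_n be a basis of V with dual basis e_i^*. For
z in the component of index q,
  sum_I Psi(z)(e_I) (x) e_I^* = q! z
where I runs over the q-tuples of indices ([Psi_q_recover]): applied to a basis
monomial e_I, the operator L(w_q) produces one term for each position k of the
letter it pairs with; resummation over the k-th index rebuilds w_q in position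
k, and the cycle produced by L(w_q), moved across the tensor sign, brings it
back to the last position. All positions contribute the same, which gives a
factor q and an induction ([contraction]). A component of index larger than q
kills degree q, so in characteristic 0 the components of an element of the
kernel of Psi vanish one after the other ([Psi_inj]).
*)

(** * Linear maps, quotients and direct sums *)

Section Linearity.
Variable K : comNzRingType.

Definition mk_linear (U W : lmodType K) (f : U -> W) (lf : linear f) :
  {linear U -> W} := HB.pack f (GRing.isLinear.Build _ _ _ _ _ lf).

Lemma linear_comb (U W : lmodType K) (f : U -> W) (n : nat)
    (a : 'I_n -> K) (x : 'I_n -> U) :
  linear f -> f (\sum_(i < n) a i *: x i) = \sum_(i < n) a i *: f (x i).
Proof.
move=> lf; rewrite -[f]/(mk_linear lf : _ -> _) linear_sum.
by apply: eq_bigr => i _; rewrite linearZ.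
Qed.

Lemma scale_add_linear (U W : lmodType K) (a : K) (f g : U -> W) :
  linear f -> linear g -> linear (fun x => a *: f x + g x).
Proof.
by move=> lf lg b x y; rewrite lf lg !scalerDr !scalerA mulrC addrACA.
Qed.

Lemma dsum_linmap_ext (I : choiceType) (M : I -> lmodType K) (W : lmodType K)
    (f g : {linear dsum M -> W}) :
  (forall i x, f (dsum_in M i x) = g (dsum_in M i x)) -> f = g.
Proof.
move=> fg; apply: linmap_ext => x.
have -> : x = \sum_(i <- dsupp x) dsum_in M i (x i).
  apply: dsum_ext => j; pose c := mk_linear (f := fun y : dsum M => y j)
    (fun a y z => erefl).
  rewrite -[RHS]/(c _) linear_sum /=.
  have [jx|jx] := boolP (j \in dsupp x).
    rewrite (bigD1_seq j) ?undup_uniq //= [X in _ + X]big1 ?addr0.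
      by rewrite dsum_in_coordE.
    by move=> i ij; rewrite dsum_in_coordN.
  rewrite big_seq big1; first exact: dsuppP.
  move=> i ix; rewrite dsum_in_coordN //.
  by apply: contraNneq jx => <-.
by rewrite !linear_sum; apply: eq_bigr => i _; exact: fg.
Qed.

Lemma lspan_sub (M : lmodType K) (S : set M) : is_submodule S -> lspan S `<=` S.
Proof. by move=> Ssub x Sx; apply: (Sx S); split. Qed.

(** Reducing modulo S turns the membership of all values of f into an equality
of linear maps, so it can be checked on generators of U by the extensionality
lemmas, without decomposing elements of U. *)
Lemma linmap_mem_submodule (U W : lmodType K) (S : set W)
    (f : {linear U -> W}) :
  is_submodule S -> (lquot_pi S \o f : {linear U -> lquot S}) = 0 ->
  forall x, S (f x).
Proof.
move=> Ssub f0 x; apply: lspan_sub => //; rewrite -[f x]subr0.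
apply/lquot_pi_eq.
rewrite -[LHS]/((lquot_pi S \o f : {linear U -> lquot S}) x) f0.
by rewrite -[LHS](linear0 (lquot_pi S)).
Qed.

Lemma lquot_pi_sub (M : lmodType K) (S : set M) x : S x -> lquot_pi S x = 0.
Proof.
move=> Sx; rewrite -[0](linear0 (lquot_pi S)).
by apply: lquot_pi_rel; rewrite subr0.
Qed.

End Linearity.

(** * Endomorphisms *)

Lemma prod_ord_recl (R : pzRingType) n (f : 'I_n.+1 -> R) (g : 'I_n -> R) :
  (forall i, f (lift ord0 i) = g i) ->
  \prod_(i < n.+1) f i = f ord0 * \prod_(i < n) g i.
Proof. by move=> fg; rewrite big_ord_recl; congr (_ * _); apply: eq_bigr. Qed.

Section Endo.
Variables (K : comNzRingType) (U : lmodType K).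
Implicit Types f g h : {linear U -> U}.

Lemma linendZl a f g : (a *: f) * g = a *: (f * g).
Proof. exact: linmap_ext. Qed.

Lemma linendZr a f g : f * (a *: g) = a *: (f * g).
Proof. by apply: linmap_ext => x; rewrite linendME !linmapZE linearZ. Qed.

Lemma linend_mul_linear f : linear (fun g => f * g).
Proof. by move=> a g h; rewrite mulrDr linendZr. Qed.

Definition linend_lmul f : {linear {linear U -> U} -> {linear U -> U}} :=
  mk_linear (linend_mul_linear f).

End Endo.

(** * Tbar(V) as an algebra *)

(** The monomial v_p ... v_1 s. It and the operators below are locked because
they are used only through their values on monomials; the iterated quotients
that define Tbar(V) stay out of sight. *)
HB.lock Definition Tmono (K : comNzRingType) (V : lmodType K) (p : nat)
  (v : {ffun 'I_p -> V}) (s : sinf) : Tbar V := Tin V p (Tpure v s).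

HB.lock Definition opL (K : comNzRingType) (V : lmodType K) (x : Tbar V) :
  {linear Tbar V -> Tbar V} := Lop x.

HB.lock Definition opV (K : comNzRingType) (V : lmodType K) (x : V) :
  {linear Tbar V -> Tbar V} := Lvec x.

HB.lock Definition opS (K : comNzRingType) (V : lmodType K) (s : sinf) :
  {linear Tbar V -> Tbar V} := Lperm V s.

HB.lock Definition opA (K : comNzRingType) (V : lmodType K)
  (phi : {linear V -> K^o}) : {linear Tbar V -> Tbar V} := Lann phi.

(** The right action of S_oo. *)
HB.lock Definition opR (K : comNzRingType) (V : lmodType K) (s : sinf) :
  {linear Tbar V -> Tbar V} := Tbar_act V s.

Section Algebra.
Variables (K : comNzRingType) (V : lmodType K).
Local Notation T := (Tbar V).

Lemma ffun0E (X : Type) (v v' : {ffun 'I_0 -> X}) : v = v'.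
Proof. by apply/ffunP => -[]. Qed.

(** The degrees of two equal monomials often agree only up to an arithmetic
identity such as associativity of addition, so families are compared entry by
entry through the values of their indices. *)
Lemma Tmono_cast p p' (v : {ffun 'I_p -> V}) (v' : {ffun 'I_p' -> V})
    (s s' : sinf) :
    p = p' -> (forall (i : 'I_p) (i' : 'I_p'), i = i' :> nat -> v i = v' i') ->
    s = s' ->
  Tmono v s = Tmono v' s'.
Proof.
move=> pp'; case: _ / pp' v' => v' vv' <-; congr (Tmono _ s).
by apply/ffunP => i; exact: vv'.
Qed.

Lemma Tbar_linmap_ext (W : lmodType K) (f g : {linear T -> W}) :
  (forall p (v : {ffun 'I_p -> V}) s, f (Tmono v s) = g (Tmono v s)) -> f = g.
Proof.
rewrite Tmono.unlock => fg; apply: dsum_linmap_ext => p x.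
have : (f \o Tin V p : {linear _ -> _}) = g \o Tin V p.
  by apply: Tp_ext => v s; exact: fg.
by move/(congr1 (fun h : {linear _ -> _} => h x)).
Qed.

Lemma opL_linear : linear (@opL K V).
Proof. by move=> a x y; rewrite opL.unlock; exact: (linearP (Tmul V)). Qed.

Lemma opL_mon p p' (v : {ffun 'I_p -> V}) s (v' : {ffun 'I_p' -> V}) s' :
  opL (Tmono v s) (Tmono v' s') = Tmono (fcat v v') (iter p' alpha s * s')%g.
Proof. by rewrite opL.unlock Tmono.unlock; exact: TmulE. Qed.

(** Associativity of concatenation, together with alpha^{p''} being a group
morphism and alpha^{p''} o alpha^{p'} = alpha^{p'' + p'}. *)
Lemma opL_monA p p' p'' (v : {ffun 'I_p -> V}) s (v' : {ffun 'I_p' -> V}) s'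
    (v'' : {ffun 'I_p'' -> V}) s'' :
  opL (opL (Tmono v s) (Tmono v' s')) (Tmono v'' s'')
  = opL (Tmono v s) (opL (Tmono v' s') (Tmono v'' s'')).
Proof.
rewrite !opL_mon; apply: Tmono_cast; first by rewrite addnA.
  move=> i i' ii'; rewrite !ffunE.
  case: (splitP i) => j ij; case: (splitP i') => k ik; rewrite ?ffunE.
  - case: (splitP k) => l kl; last first.
      by move: (ltn_ord j); rewrite -ij ii' ik kl ltnNge leq_addr.
    by congr (v'' _); apply: val_inj; rewrite /= -ij ii' ik kl.
  - by move: (ltn_ord j); rewrite -ij ii' ik -addnA ltnNge leq_addr.
  - case: (splitP k) => l kl; case: (splitP j) => l' jl.
    + by move: (ltn_ord l); rewrite -kl -ik -ii' ij ltnNge leq_addr.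
    + by move: (ltn_ord l); rewrite -kl -ik -ii' ij ltnNge leq_addr.
    + congr (v' _); apply: val_inj; apply/(@addnI p'').
      by rewrite /= -kl -jl -ij -ik.
    + by move: (ltn_ord k); rewrite -ik -ii' ij jl addnA ltnNge leq_addr.
  - case: (splitP j) => l jl.
      move: (ltn_ord l).
      by rewrite -jl -(ltn_add2l p'') -ij ii' ik ltnNge leq_addr.
    congr (v _); apply: val_inj; apply/(@addnI (p'' + p')).
    by rewrite /= -ik -ii' ij jl addnA.
by rewrite iter_alphaM -iterD mulgA.
Qed.

Lemma opL_opL (x y : T) : opL (opL x y) = opL x * opL y.
Proof.
have lin1 (z : T) : linear (fun x' : T => opL (opL x' z)).
  by move=> a x1 x2; rewrite -opL_linear opL_linear.
have lin1' (z : T) : linear (fun x' : T => opL x' * opL z).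
  by move=> a x1 x2; rewrite -linendZl -mulrDl -opL_linear.
have lin2 (z : T) : linear (fun y' : T => opL (opL z y')).
  by move=> a y1 y2; rewrite linearP opL_linear.
have lin2' (z : T) : linear (fun y' : T => opL z * opL y').
  by move=> a y1 y2; rewrite -linend_mul_linear opL_linear.
rewrite -[LHS]/(mk_linear (lin1 y) x) -[RHS]/(mk_linear (lin1' y) x).
congr (_ x); congr GRing.Linear.sort; apply: Tbar_linmap_ext => p v s.
rewrite -[LHS]/(mk_linear (lin2 (Tmono v s)) y).
rewrite -[RHS]/(mk_linear (lin2' (Tmono v s)) y).
congr (_ y); congr GRing.Linear.sort; apply: Tbar_linmap_ext => p' v' s'.
by apply: Tbar_linmap_ext => p'' v'' s''; exact: opL_monA.
Qed.

Lemma opVE (x : V) : opV x = opL (Tmono [ffun _ : 'I_1 => x] 1%g).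
Proof. by rewrite opV.unlock opL.unlock Tmono.unlock. Qed.

Lemma opSE s (v : {ffun 'I_0 -> V}) : opS V s = opL (Tmono v s).
Proof.
by rewrite (ffun0E v [ffun=> 0]) opS.unlock opL.unlock Tmono.unlock.
Qed.

Lemma iter_alpha1 p : iter p alpha 1%g = 1%g.
Proof. by elim: p => //= p ->; apply: sinf_ext => -[]. Qed.

Lemma opV_mon (x : V) p (v : {ffun 'I_p -> V}) s :
  opV x (Tmono v s) = Tmono (fcat [ffun _ : 'I_1 => x] v) s.
Proof. by rewrite opVE opL_mon iter_alpha1 mul1g. Qed.

Lemma opS_mon (t : sinf) p (v : {ffun 'I_p -> V}) s :
  opS V t (Tmono v s) = Tmono v (iter p alpha t * s)%g.
Proof.
rewrite (opSE _ [ffun=> 0]) opL_mon.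
apply: Tmono_cast => [|i i' ii'|//]; rewrite ?addn0 //.
rewrite ffunE; case: splitP => [j ij|[]//].
by congr (v _); apply: val_inj; rewrite /= -ij.
Qed.

(** The leftmost letter v_p of a monomial is its entry of index p - 1; splitting
it off is the basis of all inductions on the degree. *)
Lemma Tmono_cons p (v : {ffun 'I_p.+1 -> V}) s :
  Tmono v s = opV (v ord_max) (Tmono (fdel v ord_max) s).
Proof.
rewrite opV_mon; apply: Tmono_cast => [|i i' ii'|//]; rewrite ?addn1 //.
rewrite ffunE; case: splitP => j ij; rewrite !ffunE.
  by congr (v _); apply: ord_inj; rewrite lift_max ii'.
by congr (v _); apply: ord_inj; rewrite ii' ij ord1 addn0.
Qed.

Lemma opL_cons p (v : {ffun 'I_p.+1 -> V}) s :
  opL (Tmono v s) = opV (v ord_max) * opL (Tmono (fdel v ord_max) s).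
Proof. by rewrite Tmono_cons opVE opL_opL. Qed.

Lemma opL_monE p (v : {ffun 'I_p -> V}) s :
  opL (Tmono v s) = (\prod_(i < p) opV (v (rev_ord i))) * opS V s.
Proof.
elim: p v => [|p IH] v; first by rewrite big_ord0 mul1r (opSE _ v).
rewrite opL_cons IH mulrA; congr (_ * _).
rewrite [RHS](prod_ord_recl (g := fun i => opV (fdel v ord_max (rev_ord i)))).
  by congr (opV (v _) * _); apply: ord_inj; rewrite /= subn1.
move=> i; rewrite ffunE; congr (opV (v _)).
by apply: ord_inj; rewrite lift_max /= /bump /= add1n subSS.
Qed.

Lemma opS1 : opS V 1%g = 1.
Proof.
by apply: Tbar_linmap_ext => p v s; rewrite opS_mon iter_alpha1 mul1g.
Qed.

Lemma opSM s t : opS V s * opS V t = opS V (s * t)%g.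
Proof.
apply: Tbar_linmap_ext => p v r; rewrite linendME !opS_mon.
by rewrite iter_alphaM mulgA.
Qed.

Lemma opS_opV s x : opS V s * opV x = opV x * opS V (alpha s).
Proof.
apply: Tbar_linmap_ext => p v r; rewrite !linendME opV_mon !opS_mon opV_mon.
by congr (Tmono _ (_ * _)%g); rewrite addn1 iterSr.
Qed.

End Algebra.

(** * Inserting an entry into a family *)

Section Insertion.

Definition ffun_ins (X : Type) q (k : 'I_q.+1) (u : {ffun 'I_q -> X}) (x : X) :
  {ffun 'I_q.+1 -> X} :=
  [ffun j => if unlift k j is Some i then u i else x].

Lemma ffun_ins_at (X : Type) q (k : 'I_q.+1) (u : {ffun 'I_q -> X}) x :
  ffun_ins k u x k = x.
Proof. by rewrite ffunE unlift_none. Qed.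

Lemma ffun_ins_lift (X : Type) q (k : 'I_q.+1) (u : {ffun 'I_q -> X}) x i :
  ffun_ins k u x (lift k i) = u i.
Proof. by rewrite ffunE liftK. Qed.

Lemma ffun_ins_sum (W : nmodType) (n q : nat) (k : 'I_q.+1)
    (F : {ffun 'I_q.+1 -> 'I_n} -> W) :
  \sum_I F I = \sum_(J : {ffun 'I_q -> 'I_n}) \sum_(i < n) F (ffun_ins k J i).
Proof.
rewrite pair_big /= (reindex (fun J => ffun_ins k J.1 J.2)) //=.
exists (fun I : {ffun 'I_q.+1 -> 'I_n} =>
  ([ffun j => I (lift k j)] : {ffun 'I_q -> 'I_n}, I k)).
  move=> [J i] _ /=; rewrite ffun_ins_at; congr (_, _).
  by apply/ffunP => j; rewrite ffunE ffun_ins_lift.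
move=> I _ /=; apply/ffunP => j.
by case: (unliftP k j) => [l|] ->; rewrite ?ffun_ins_lift ?ffun_ins_at ?ffunE.
Qed.

Variables (K : comNzRingType) (U : lmodType K).

Lemma ffun_ins_fdel q (k : 'I_q.+1) (w : {ffun 'I_q.+1 -> U}) :
  ffun_ins k (fdel w k) (w k) = w.
Proof.
apply/ffunP => j; case: (unliftP k j) => [i|] ->; last by rewrite ffun_ins_at.
by rewrite ffun_ins_lift ffunE.
Qed.

Lemma ffun_ins_repl_at q (k : 'I_q.+1) (u : {ffun 'I_q -> U}) x y :
  ffun_ins k u x = repl (ffun_ins k u y) k x.
Proof.
apply/ffunP => j; rewrite [RHS]ffunE.
have [->|jk] := eqVneq j k; first exact: ffun_ins_at.
by case: (unliftP k j) jk => [i|] ->; rewrite ?eqxx // !ffun_ins_lift.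
Qed.

Lemma ffun_ins_repl q (k : 'I_q.+1) (u : {ffun 'I_q -> U}) i x y :
  ffun_ins k (repl u i x) y = repl (ffun_ins k u y) (lift k i) x.
Proof.
apply/ffunP => j; rewrite [RHS]ffunE.
case: (unliftP k j) => [l|] ->; last first.
  by rewrite !ffun_ins_at (negbTE (neq_lift _ _)).
by rewrite !ffun_ins_lift ffunE (inj_eq lift_inj).
Qed.

(** The permutation of the index set that underlies [cyc k] moves an entry
inserted at position k to the last position. *)
Lemma reidx_ffun_ins q (k : 'I_q.+1) (u : {ffun 'I_q -> U}) x :
  reidx (ffun_ins k u x) (lift_perm k ord_max 1%g)^-1%g = ffun_ins ord_max u x.
Proof.
apply/ffunP => j; rewrite ffunE lift_permV invg1.
case: (unliftP ord_max j) => [l|] ->.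
  by rewrite lift_perm_lift perm1 !ffun_ins_lift.
by rewrite lift_perm_id !ffun_ins_at.
Qed.

Lemma reidx_ffun_ins_lift q (k : 'I_q.+1) (u : {ffun 'I_q -> U}) x s :
  ffun_ins k (reidx u s) x = reidx (ffun_ins k u x) (lift_perm k k s).
Proof.
apply/ffunP => j; rewrite [RHS]ffunE.
case: (unliftP k j) => [l|] ->.
  by rewrite lift_perm_lift !ffun_ins_lift ffunE.
by rewrite lift_perm_id !ffun_ins_at.
Qed.

Lemma multilinear_ins (W : lmodType K) q (f : {ffun 'I_q.+1 -> U} -> W) k u :
  multilinear f -> linear (fun x => f (ffun_ins k u x)).
Proof.
move=> fM a x y; have E z := ffun_ins_repl_at k u z 0.
by rewrite (E (a *: x + y)) (E x) (E y) fM.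
Qed.

End Insertion.

(** * The transposition of the first two letters *)

Definition sinf_swap : sinf := sinf_perm (tperm ord0 ord_max : 'S_2).

Lemma sinf_swapE k :
  sinf_swap k = if k is 0%N then 1%N else if k is 1%N then 0%N else k.
Proof.
case: k => [|[|k]]; last exact: sinf_perm_ge.
  by rewrite /sinf_swap (sinf_perm_ord _ ord0) tpermL.
by rewrite /sinf_swap (sinf_perm_ord _ ord_max) tpermR.
Qed.

Lemma sinf_swapK : (sinf_swap * sinf_swap)%g = 1%g.
Proof.
by apply: sinf_ext => k; rewrite sinfME !sinf_swapE; case: k => [|[]].
Qed.

Lemma sinf_swap_braid :
  (sinf_swap * alpha sinf_swap * sinf_swap)%g
  = (alpha sinf_swap * sinf_swap * alpha sinf_swap)%g.
Proof.
have swapE := (sinf_swapE 0, sinf_swapE 1, fun k => sinf_swapE k.+2).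
have aS k : alpha sinf_swap k.+1 = (sinf_swap k).+1 by [].
have a0 : alpha sinf_swap 0 = 0%N by [].
by apply: sinf_ext => -[|[|[|k]]]; rewrite !sinfME !(swapE, a0, aS).
Qed.

Lemma cyc_ord_max m : cyc (ord_max : 'I_m.+1) = 1%g.
Proof.
apply: sinf_ext => j; rewrite cycE sinf1E; case: eqP => [->//|_].
by case: ltnP => //= mj; rewrite leqNgt mj.
Qed.

(** With letters numbered from 0, alpha^m s is the transposition of m and m + 1,
and (m+1 m ... k) = (m+1 m) (m ... k). *)
Lemma cyc_widen m (k : 'I_m.+1) :
  cyc (widen_ord (leqnSn m.+1) k) = (iter m alpha sinf_swap * cyc k)%g.
Proof.
apply: sinf_ext => j; rewrite sinfME !cycE iter_alphaE sinf_swapE /=.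
have km : (k <= m)%N by rewrite -ltnS.
have [_|jk] := eqVneq j (k : nat); first by rewrite ltnn subnn add1n.
have [kj|jk'] /= := ltnP k j; last first.
  by rewrite (leq_trans _ km) // ltn_neqAle jk.
case: j jk kj => // j _ kj /=; rewrite ltnS.
case: (ltngtP j m) => jm.
- by rewrite jm.
- rewrite ltnNge (leq_trans (ltnW jm)) //= subSn ?(ltnW jm) //.
  have : (0 < j - m)%N by rewrite subn_gt0.
  by case E : (j - m)%N => [//|n] _; rewrite -E addSn subnK // ltnW.
- by rewrite jm ltnNge leqnSn /= subSnn add0n.
Qed.

(** * Commutation relations *)

Section Annihilation.
Variables (K : comNzRingType) (V : lmodType K).
Local Notation T := (Tbar V).
Implicit Types phi psi : {linear V -> K^o}.

Lemma opA_mon0 phi (v : {ffun 'I_0 -> V}) t : opA phi (Tmono v t) = 0.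
Proof. by rewrite opA.unlock Tmono.unlock; exact: Lann0E. Qed.

Lemma opA_mon phi p (v : {ffun 'I_p.+1 -> V}) t :
  opA phi (Tmono v t)
  = \sum_(k < p.+1) (phi (v k) : K) *: Tmono (fdel v k) (cyc k * t)%g.
Proof. by rewrite opA.unlock Tmono.unlock; exact: LannE. Qed.

Lemma fdel_widen_max p (v : {ffun 'I_p.+2 -> V}) (k : 'I_p.+1) :
  fdel v (widen_ord (leqnSn p.+1) k) ord_max = v ord_max.
Proof.
rewrite ffunE; congr (v _); apply: ord_inj => /=.
by rewrite /bump -ltnS ltn_ord add1n.
Qed.

Lemma fdel_widen p (v : {ffun 'I_p.+2 -> V}) (k : 'I_p.+1) :
  fdel (fdel v (widen_ord (leqnSn p.+1) k)) ord_max = fdel (fdel v ord_max) k.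
Proof.
apply/ffunP => j; rewrite !ffunE; congr (v _); apply: ord_inj.
by rewrite lift_max -[LHS]/(bump k (lift ord_max j)) lift_max.
Qed.

(** The summand that pairs phi with the leftmost letter carries the trivial
cycle and gives the scalar term. In the others the leftmost letter survives,
and by [cyc_widen] their cycle is that of the shorter monomial followed by a
transposition of the two top letters, which is how s acts after L(v) is pulled
out. *)
Lemma opA_cons phi p (v : {ffun 'I_p.+1 -> V}) t :
  opA phi (Tmono v t) = (phi (v ord_max) : K) *: Tmono (fdel v ord_max) t
    + opV (v ord_max) (opS V sinf_swap (opA phi (Tmono (fdel v ord_max) t))).
Proof.
rewrite opA_mon big_ord_recr /= cyc_ord_max mul1g addrC; congr (_ + _).
case: p v => [|p] v; first by rewrite big_ord0 opA_mon0 !linear0.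
rewrite opA_mon !linear_sum; apply: eq_bigr => k _.
rewrite !linearZ opS_mon Tmono_cons fdel_widen_max fdel_widen cyc_widen mulgA.
suff -> : v (widen_ord (leqnSn p.+1) k) = fdel v ord_max k by [].
by rewrite ffunE; congr (v _); apply: ord_inj; rewrite lift_max.
Qed.

Lemma opA_opV phi x (y : T) :
  opA phi (opV x y) = (phi x : K) *: y + opV x (opS V sinf_swap (opA phi y)).
Proof.
have rhs_lin : linear (fun z =>
    (phi x : K) *: z + opV x (opS V sinf_swap (opA phi z))).
  move=> a z z'; rewrite (linearP (opA phi)) (linearP (opS V sinf_swap)).
  by rewrite (linearP (opV x)) !scalerDr !scalerA [_ * a]mulrC addrACA.
rewrite -[LHS]/((opA phi * opV x) y) -[RHS]/(mk_linear rhs_lin y).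
congr (_ y); congr GRing.Linear.sort; apply: Tbar_linmap_ext => p v t.
rewrite linendME /=.
pose u := ffun_ins ord_max v x.
have um : u ord_max = x by exact: ffun_ins_at.
have uv : fdel u ord_max = v by apply/ffunP => j; rewrite ffunE ffun_ins_lift.
by have := opA_cons phi u t; rewrite (Tmono_cons u) um uv.
Qed.

Lemma Tbar_mon_ind (P : T -> Prop) :
  (forall (v : {ffun 'I_0 -> V}) s, P (Tmono v s)) ->
  (forall x y, P y -> P (opV x y)) ->
  forall p (v : {ffun 'I_p -> V}) s, P (Tmono v s).
Proof.
move=> P0 PV; elim=> [|p IH] v s; first exact: P0.
by rewrite Tmono_cons; apply: PV.
Qed.

Lemma Tbar_op_ext (f g : {linear T -> T}) :
  (forall (v : {ffun 'I_0 -> V}) s, f (Tmono v s) = g (Tmono v s)) ->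
  (forall x y, f y = g y -> f (opV x y) = g (opV x y)) -> f = g.
Proof.
move=> fg0 fgV; apply: Tbar_linmap_ext.
exact: (Tbar_mon_ind (P := fun y => f y = g y)).
Qed.

Lemma opS_opVE s x (y : T) : opS V s (opV x y) = opV x (opS V (alpha s) y).
Proof. exact: (congr1 (fun f : {linear T -> T} => f y) (opS_opV s x)). Qed.

Lemma opSME s t (y : T) : opS V s (opS V t y) = opS V (s * t)%g y.
Proof. exact: (congr1 (fun f : {linear T -> T} => f y) (@opSM K V s t)). Qed.

Lemma opS1E (y : T) : opS V 1%g y = y.
Proof. by rewrite opS1. Qed.

(** Induction on the degree for all s at once, because moving s past a letter
turns it into alpha s. The transposition from [opA_opV] commutes with
alpha (alpha s), which fixes the first two letters. *)
Lemma opA_opS phi s : opA phi * opS V s = opS V (alpha s) * opA phi.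
Proof.
apply: Tbar_linmap_ext => p v t; move: p v t s.
pose P y := forall s, opA phi (opS V s y) = opS V (alpha s) (opA phi y).
apply: (Tbar_mon_ind (P := P)) => [v t s|x y IH s].
  by rewrite opS_mon !opA_mon0 linear0.
rewrite opS_opVE !opA_opV linearD linearZ opS_opVE /=.
congr (_ + opV _ _); rewrite IH !opSME; congr (opS V _ _).
exact: (esym (iter_alpha_comm s (tperm ord0 ord_max : 'S_2))).
Qed.

Lemma opA_opSE phi s (y : T) :
  opA phi (opS V s y) = opS V (alpha s) (opA phi y).
Proof. exact: (congr1 (fun f : {linear T -> T} => f y) (opA_opS phi s)). Qed.

(** Expanding both sides on L(x) y by [opA_opV], the two terms with one
annihilator are exchanged (s being an involution), and the terms with two
agree by induction and the braid relation. *)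
Lemma opA_opA phi psi :
  opA phi * opA psi = opS V sinf_swap * (opA psi * opA phi).
Proof.
apply: Tbar_op_ext => [v t|x y].
  by rewrite !linendME !opA_mon0 !linear0.
rewrite !linendME => IH.
rewrite !opA_opV [opA phi (_ + _)]linearD [opA phi (_ *: _)]linearZ /=.
rewrite [opA psi (_ + _)]linearD [opA psi (_ *: _)]linearZ /= !opA_opV.
rewrite !(linearD (opS V sinf_swap)).
rewrite [opS V sinf_swap (_ *: opA psi _)]linearZ /=.
rewrite [opS V sinf_swap (_ *: opS _ _ _)]linearZ /=.
rewrite !opA_opSE IH opS_opVE !opSME sinf_swapK opS1E sinf_swap_braid.
by rewrite addrCA.
Qed.

End Annihilation.

(** * Permuting annihilation operators *)

Lemma sinf_perm_adjacent q (i j : 'I_q) :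
  j = i.+1 :> nat -> sinf_perm (tperm i j) = iter i alpha sinf_swap.
Proof.
move=> ji; apply: sinf_ext => k; rewrite iter_alphaE sinf_swapE.
have [kq|qk] := ltnP k q; last first.
  have jk : (i.+1 < k)%N by rewrite -ji (leq_trans (ltn_ord j)).
  rewrite sinf_perm_ge // ltnNge (ltnW (ltnW jk)) /=.
  have : (1 < k - i)%N by rewrite ltn_subRL addn1.
  by case E : (k - i)%N => [|[|n]] // _; rewrite -E subnK // (ltnW (ltnW jk)).
rewrite (sinf_perm_ord _ (Ordinal kq)).
case: tpermP => [/(congr1 val)|/(congr1 val)|/eqP ki /eqP kj] /=.
- by move=> ->; rewrite ltnn subnn ji add1n.
- by move=> ->; rewrite ji ltnNge leqnSn /= subSnn add0n.
rewrite -val_eqE /= in ki; rewrite -val_eqE /= ji in kj.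
case: (ltngtP k i) ki kj => // ik _ kj.
have {kj ik} : (1 < k - i)%N by rewrite ltn_subRL addn1 ltn_neqAle eq_sym kj.
case E : (k - i)%N => [|[|n]] // _; rewrite -E subnK //.
by rewrite ltnW // -subn_gt0 E.
Qed.

(** Only the relations matter here, so S and D are arbitrary families in a ring
that satisfy those of the L(sigma) and the L(v^* ). *)
Section Exchange.
Variables (R : pzRingType) (X : Type) (S : sinf -> R) (D : X -> R).
Hypothesis S1 : S 1%g = 1.
Hypothesis SM : forall s t, S s * S t = S (s * t)%g.
Hypothesis DS : forall x s, D x * S s = S (alpha s) * D x.
Hypothesis DD : forall x y, D x * D y = S sinf_swap * (D y * D x).

(** alpha^i s passes through the first i factors and loses one alpha at each; it
reaches factors i and i + 1 as s, and exchanges them. *)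
Lemma exchange_adjacent i q (w : nat -> X) : (i.+1 < q)%N ->
  S (iter i alpha sinf_swap) * \prod_(j < q) D (w j)
  = \prod_(j < q) D (w (iter i alpha sinf_swap j)).
Proof.
elim: i q w => [|i IH] [|q] // w; rewrite ltnS => iq.
  case: q iq => // q _; rewrite !big_ord_recl !mulrA -[S _ * _ * _]mulrA -DD.
  congr (_ * _); first by rewrite !sinf_swapE.
  by apply: eq_bigr => j _; rewrite sinf_swapE.
rewrite !big_ord_recl mulrA -DS -mulrA; congr (_ * _).
exact: (IH q (fun n => w n.+1)).
Qed.

Definition exchanges q (s : 'S_q) := forall w : 'I_q -> X,
  S (sinf_perm s) * \prod_(j < q) D (w j) = \prod_(j < q) D (w (s^-1%g j)).

Lemma exchangesM q (s t : 'S_q) :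
  exchanges s -> exchanges t -> exchanges (s * t)%g.
Proof.
move=> Es Et w; rewrite sinf_permM -SM -mulrA Es Et.
by apply: eq_bigr => j _; rewrite invMg permM.
Qed.

Lemma exchanges_adjacent q (i j : 'I_q) :
  j = i.+1 :> nat -> exchanges (tperm i j).
Proof.
move=> ji w; rewrite tpermV sinf_perm_adjacent //.
pose w' n := w (insubd i n).
have w'E (k : 'I_q) : w' k = w k by rewrite /w' valKd.
have := @exchange_adjacent i q w'; rewrite -ji ltn_ord => /(_ isT).
under eq_bigr do rewrite w'E; move=> ->.
by apply: eq_bigr => k _; rewrite -(sinf_perm_adjacent ji) sinf_perm_ord w'E.
Qed.

(** (i j) is the conjugate of (i j-1) by the adjacent transposition (j-1 j). *)
Lemma exchanges_tperm_lt q n (i j : 'I_q) :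
  j = (i + n.+1)%N :> nat -> exchanges (tperm i j).
Proof.
elim: n j => [|n IH] j ji; first by apply: exchanges_adjacent; rewrite ji addn1.
have kq : (i + n.+1 < q)%N by rewrite (ltn_trans _ (ltn_ord j)) // ji ltn_add2l.
pose k := Ordinal kq.
have kj : exchanges (tperm k j) by apply: exchanges_adjacent; rewrite ji addnS.
have -> : tperm i j = (tperm k j * (tperm i k * tperm k j))%g.
  rewrite -{1}(tpermV k j) -[RHS]/(tperm i k ^ tperm k j)%g.
  rewrite tpermJ tpermL tpermD //.
    by rewrite -val_eqE /= -[X in _ != X]addn0 eqn_add2l.
  by rewrite -val_eqE /= ji -[X in _ != X]addn0 eqn_add2l.
by do !apply: exchangesM => //; apply: IH.
Qed.

Lemma exchange_perm q (s : 'S_q) : exchanges s.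
Proof.
have E1 : exchanges (1%g : 'S_q).
  move=> w; rewrite invg1 sinf_perm1 S1 mul1r.
  by apply: eq_bigr => k _; rewrite perm1.
have Elt (i j : 'I_q) : (i < j)%N -> exchanges (tperm i j).
  move=> ij; apply: (@exchanges_tperm_lt _ (j - i).-1).
  by rewrite prednK ?subn_gt0 // subnKC // ltnW.
have Et (i j : 'I_q) : exchanges (tperm i j).
  case: (ltngtP i j) => [ij|ij|/val_inj ->]; first exact: Elt.
    by rewrite tpermC; apply: Elt.
  by rewrite tperm1.
have [ts -> _] := prod_tpermP s; elim: ts => [|t ts IH]; last first.
  by rewrite big_cons; apply: exchangesM.
by rewrite big_nil.
Qed.

End Exchange.

(** * The right action of permutations *)

Section RightAction.
Variables (K : comNzRingType) (V : lmodType K).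
Local Notation T := (Tbar V).

Lemma opR_mon s p (v : {ffun 'I_p -> V}) t :
  opR V s (Tmono v t) = Tmono v (t * s)%g.
Proof.
rewrite opR.unlock Tmono.unlock /Tbar_act Tbar_liftE.
by congr (Tin V p _); exact: Tp_liftE.
Qed.

Lemma opR1 : opR V 1%g = 1.
Proof. by apply: Tbar_linmap_ext => p v t; rewrite opR_mon mulg1. Qed.

(** This reduces the compatibility of the right action with left
multiplications to associativity. *)
Lemma opR_opL s (x : T) : opR V s x = opL x (Tmono [ffun _ : 'I_0 => 0] s).
Proof.
have lin : linear (fun x : T => opL x (Tmono [ffun _ : 'I_0 => 0] s)).
  by move=> a y z; rewrite opL_linear.
rewrite -[RHS]/(mk_linear lin x); congr (_ x); congr GRing.Linear.sort.
apply: Tbar_linmap_ext => p v t; rewrite opR_mon /= opL_mon.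
apply: Tmono_cast => // i i' ii'; rewrite ffunE.
case: splitP => [[]//|j ij].
by congr (v _); apply: ord_inj; rewrite ii' ij.
Qed.

Lemma opL_opR s (x : T) : opL (opR V s x) = opL x * opS V s.
Proof. by rewrite opR_opL opL_opL (opSE _ [ffun=> 0]). Qed.

Lemma opA_opR (phi : {linear V -> K^o}) s (x : T) :
  opA phi (opR V s x) = opR V s (opA phi x).
Proof.
rewrite -[LHS]/((opA phi * opR V s) x) -[RHS]/((opR V s * opA phi) x).
congr (_ x); congr GRing.Linear.sort.
apply: Tbar_linmap_ext => p v t; rewrite !linendME opR_mon.
case: p v => [|p] v; first by rewrite !opA_mon0 linear0.
rewrite !opA_mon linear_sum; apply: eq_bigr => k _.
by rewrite linearZ opR_mon mulgA.
Qed.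

Lemma opL_opR_app s (x y : T) : opL x (opR V s y) = opR V s (opL x y).
Proof. by rewrite !opR_opL opL_opL. Qed.

End RightAction.

(** * Products of annihilation operators *)

Section Products.
Variables (K : comNzRingType) (T U : lmodType K).
Variable D : U -> {linear T -> T}.
Hypothesis D_linear : linear D.

Lemma prod_multilinear q :
  multilinear (fun w : {ffun 'I_q -> U} => \prod_(j < q) D (w j)).
Proof.
elim: q => [|q IH] w i a x y; first by case: i.
pose w' : {ffun 'I_q -> U} := fdel w ord0.
case: (unliftP ord0 i) => [k|] ->.
  have P z : \prod_(j < q.+1) D (repl w (lift ord0 k) z j)
    = D (w ord0) * \prod_(j < q) D (repl w' k z j).
    rewrite (prod_ord_recl (g := fun j => D (repl w' k z j))).
      by rewrite ffunE (negbTE (neq_lift _ _)).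
    by move=> j; rewrite !ffunE (inj_eq lift_inj).
  by rewrite !P IH linend_mul_linear.
have P z : \prod_(j < q.+1) D (repl w ord0 z j) = D z * \prod_(j < q) D (w' j).
  rewrite (prod_ord_recl (g := fun j => D (w' j))); first by rewrite ffunE eqxx.
  by move=> j; rewrite !ffunE eq_sym (negbTE (neq_lift _ _)).
by rewrite !P D_linear mulrDl linendZl.
Qed.

End Products.

Section Annihilators.
Variables (K : fieldType) (V : vectType K).
Local Notation T := (Tbar V).
Local Notation dual := (dual V).

Lemma opA_linear : linear (fun w : dual => opA w : {linear T -> T}).
Proof.
move=> a w w'; apply: Tbar_linmap_ext => p v t.
rewrite linmapDE linmapZE; case: p v => [|p] v.
  by rewrite !opA_mon0 scaler0 addr0.
rewrite !opA_mon scaler_sumr -big_split /=; apply: eq_bigr => k _.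
by rewrite add_lfunE scale_lfunE scalerDl scalerA.
Qed.

Definition annih q (w : {ffun 'I_q -> dual}) : {linear T -> T} :=
  \prod_(j < q) opA (w j).

Lemma annih_multilinear q : multilinear (@annih q).
Proof. exact: prod_multilinear opA_linear _. Qed.

Lemma annih_cons (x : dual) q (w : {ffun 'I_q -> dual}) :
  opA x * annih w = annih (ffun_ins ord0 w x).
Proof.
rewrite [RHS](prod_ord_recl (g := fun j => opA (w j))).
  by rewrite ffun_ins_at.
by move=> j; rewrite ffun_ins_lift.
Qed.

Lemma annih_rcons q (w : {ffun 'I_q.+1 -> dual}) (y : T) :
  annih w y = annih (fdel w ord_max) (opA (w ord_max) y).
Proof.
rewrite -[RHS]/((annih (fdel w ord_max) * opA (w ord_max)) y).
congr (_ y); congr GRing.Linear.sort; rewrite /annih big_ord_recr /=.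
congr (_ * _); apply: eq_bigr => j _; rewrite ffunE.
suff -> : widen_ord (leqnSn q) j = lift ord_max j by [].
by apply: ord_inj; rewrite lift_max.
Qed.

Lemma annih_opR q (w : {ffun 'I_q -> dual}) s (y : T) :
  annih w (opR V s y) = opR V s (annih w y).
Proof.
elim: q w y => [|q IH] w y; first by rewrite /annih !big_ord0.
by rewrite !annih_rcons opA_opR IH.
Qed.

Lemma annih_lt q p (w : {ffun 'I_q -> dual}) (v : {ffun 'I_p -> V}) s :
  (p < q)%N -> annih w (Tmono v s) = 0.
Proof.
elim: q p w v s => // q IH [|p] w v s; rewrite ltnS => pq.
  by rewrite annih_rcons opA_mon0 linear0.
rewrite annih_rcons opA_mon linear_sum big1 // => k _.
by rewrite linearZ IH //= scaler0.
Qed.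

Lemma annih_perm q (w : {ffun 'I_q -> dual}) (s : 'S_q) :
  opS V (sinf_perm s) * annih w = annih (reidx w s^-1%g).
Proof.
rewrite (exchange_perm (S := opS V)
  (D := fun w : dual => opA w : {linear T -> T})).
- by apply: eq_bigr => j _; rewrite ffunE.
- exact: opS1.
- exact: opSM.
- by move=> x t; exact: opA_opS.
- by move=> x y; exact: opA_opA.
Qed.

End Annihilators.

(** * Contraction with a basis and its dual *)

Section DualBasis.
Variables (K : fieldType) (V : vectType K).
Local Notation n := (\dim {:V}).

Definition bvec (i : 'I_n) : V := (vbasis {:V})`_i.

Definition bdual (i : 'I_n) : dual V :=
  linfun (mk_linear (W := K^o) (f := coord (vbasis {:V}) i)
    (@coord_is_scalar _ _ _ (vbasis {:V}) i)).

Lemma dual_expansion (w : dual V) : w = \sum_(i < n) w (bvec i) *: bdual i.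
Proof.
apply/lfunP => x; rewrite sum_lfunE.
rewrite {1}(coord_vbasis (memvf x)) linear_sum; apply: eq_bigr => i _.
by rewrite scale_lfunE lfunE linearZ /= [RHS]mulrC.
Qed.

End DualBasis.

Section Contraction.
Variables (K : fieldType) (V : vectType K).
Local Notation T := (Tbar V).
Local Notation dual := (dual V).
Local Notation n := (\dim {:V}).

Definition Tbasis q (I : {ffun 'I_q -> 'I_n}) : T :=
  Tmono [ffun k => bvec (I k)] 1%g.

Definition dbasis q (I : {ffun 'I_q -> 'I_n}) : {ffun 'I_q -> dual} :=
  [ffun k => bdual (I k)].

Lemma dbasis_ins q (k : 'I_q.+1) (J : {ffun 'I_q -> 'I_n}) i :
  dbasis (ffun_ins k J i) = ffun_ins k (dbasis J) (bdual i).
Proof.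
apply/ffunP => j; rewrite ffunE.
by case: (unliftP k j) => [l|] ->; rewrite ?ffun_ins_lift ?ffun_ins_at ?ffunE.
Qed.

Lemma opA_Tbasis (w : dual) q (I : {ffun 'I_q.+1 -> 'I_n}) :
  opA w (Tbasis I)
  = \sum_(k < q.+1) (w (bvec (I k)) : K)
      *: opR V (cyc k) (Tbasis [ffun j => I (lift k j)]).
Proof.
rewrite opA_mon; apply: eq_bigr => k _; rewrite ffunE; congr (_ *: _).
rewrite opR_mon mulg1 mul1g; congr (Tmono _ _).
by apply/ffunP => j; rewrite !ffunE.
Qed.

(** B is a balanced pairing, that is, a linear map on the tensor product over
S_q; keeping it arbitrary allows the induction to absorb the last covector into it.
For each position k of the letter paired with the last covector
x, summation over the k-th index turns the dual basis vector at k into x by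
[dual_expansion], and balancing carries [cyc k] over to move x to the end. So
the q + 1 positions give the same sum, that of the induction hypothesis. *)
Lemma contraction (W : lmodType K) q (B : T -> {ffun 'I_q -> dual} -> W)
    (w : {ffun 'I_q -> dual}) :
  (forall u, linear (B^~ u)) -> (forall y, multilinear (B y)) ->
  (forall s y u, B (opR V (sinf_perm s) y) u = B y (reidx u s^-1%g)) ->
  \sum_I B (annih w (Tbasis I)) (dbasis I)
  = (q`!)%:R *: B (Tmono [ffun _ : 'I_0 => 0] 1%g) w.
Proof.
elim: q B w => [|q IH] B w Bl Bm Bs.
  rewrite (eq_bigr (fun _ => B (Tmono [ffun _ : 'I_0 => 0] 1%g) w)); last first.
    move=> I _; rewrite (ffun0E (dbasis I) w) /annih big_ord0 linend1E.
    by congr (B _ _); congr (Tmono _ _); exact: ffun0E.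
  by rewrite sumr_const card_ffun !card_ord expn0 scale1r.
pose x := w ord_max; pose w' := fdel w ord_max.
pose B' y u := B y (ffun_ins ord_max u x).
have IHB : \sum_I B' (annih w' (Tbasis I)) (dbasis I)
    = (q`!)%:R *: B (Tmono [ffun _ : 'I_0 => 0] 1%g) w.
  rewrite IH /B' ?ffun_ins_fdel //.
  - by move=> y u i a z z'; rewrite !ffun_ins_repl Bm.
  - move=> s y u; rewrite reidx_ffun_ins_lift -lift_permV -Bs.
    by rewrite sinf_perm_lift.
have step (k : 'I_q.+1) :
    \sum_(I : {ffun 'I_q.+1 -> 'I_n}) (x (bvec (I k)) : K)
      *: B (annih w' (opR V (cyc k) (Tbasis [ffun j => I (lift k j)]))) (dbasis I)
    = (q`!)%:R *: B (Tmono [ffun _ : 'I_0 => 0] 1%g) w.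
  rewrite -IHB (ffun_ins_sum k); apply: eq_bigr => J _.
  have EJ i : [ffun j => ffun_ins k J i (lift k j)] = J.
    by apply/ffunP => j; rewrite ffunE ffun_ins_lift.
  rewrite /B' [X in ffun_ins _ _ X](dual_expansion x).
  rewrite (linear_comb _ _ (multilinear_ins ord_max (dbasis J) (Bm _))).
  apply: eq_bigr => i _; rewrite EJ ffun_ins_at annih_opR Bs dbasis_ins.
  by rewrite reidx_ffun_ins.
have expand (I : {ffun 'I_q.+1 -> 'I_n}) :
    B (annih w (Tbasis I)) (dbasis I) = \sum_(k < q.+1) (x (bvec (I k)) : K)
      *: B (annih w' (opR V (cyc k) (Tbasis [ffun j => I (lift k j)]))) (dbasis I).
  rewrite annih_rcons opA_Tbasis.
  pose annihl := linearP (annih w').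
  by rewrite (linear_comb _ _ annihl) (linear_comb _ _ (Bl _)).
rewrite (eq_bigr _ (fun I _ => expand I)) exchange_big /=.
rewrite (eq_bigr _ (fun k _ => step k)) sumr_const card_ord.
by rewrite factS natrM -scalerA [RHS]scaler_nat.
Qed.

End Contraction.

(** * The map Psi *)

HB.lock Definition Tbarten (K : fieldType) (V : vectType K) (q : nat)
  (x : Tbar V) (w : {ffun 'I_q -> dual V}) : Tbarq V q := tensor _ _ x (tpure w).

HB.lock Definition Tsingle_in (K : fieldType) (V : vectType K) (q : nat) :
  {linear Tbarq V q -> Tsingle V} :=
  dsum_in (fun q : nat => Tbarq V q : lmodType K) q.

Section NormalOrder.
Variables (K : fieldType) (V : vectType K).
Local Notation T := (Tbar V).
Local Notation dual := (dual V).
Local Notation EndT := {linear T -> T}.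

Lemma Tbarten_linear q (w : {ffun 'I_q -> dual}) : linear (fun x => Tbarten x w).
Proof. by move=> a x y; rewrite Tbarten.unlock; exact: tensorPl. Qed.

Lemma Tbarten_multilinear q (x : T) :
  multilinear (fun w : {ffun 'I_q -> dual} => Tbarten x w).
Proof.
by move=> w i a y z; rewrite Tbarten.unlock tpure_multilinear; exact: tensorPr.
Qed.

Lemma Tbarten_balanced q (s : 'S_q) (x : T) (w : {ffun 'I_q -> dual}) :
  Tbarten (opR V (sinf_perm s) x) w = Tbarten x (reidx w s^-1%g).
Proof.
have B := tensorB (fun s : 'S_q => Tbar_act V (sinf_perm s)) (@dual_act K V q)
  s x (tpure w).
have D : dual_act V s (tpure w) = tpure (reidx w s^-1%g) by exact: tpow_permE.
rewrite Tbarten.unlock opR.unlock -D.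
exact B.
Qed.

Lemma Tbarq_linmap_ext q (W : lmodType K) (f g : {linear Tbarq V q -> W}) :
  (forall x w, f (Tbarten x w) = g (Tbarten x w)) -> f = g.
Proof.
rewrite Tbarten.unlock => fg; apply: tens_ext => x t.
set L := tensor_lin (fun s : 'S_q => Tbar_act V (sinf_perm s))
  (@dual_act K V q) x.
have : (f \o L : {linear _ -> _}) = g \o L.
  by apply: tpow_ext => w; exact: fg.
by move/(congr1 (fun h : {linear _ -> _} => h t)).
Qed.

Lemma Tsingle_linmap_ext (W : lmodType K) (f g : {linear Tsingle V -> W}) :
  (forall q (x : T) (w : {ffun 'I_q -> dual}),
    f (Tsingle_in V q (Tbarten x w)) = g (Tsingle_in V q (Tbarten x w))) ->
  f = g.
Proof.
rewrite Tsingle_in.unlock => fg; apply: dsum_linmap_ext => q z.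
set L := dsum_in (fun q : nat => Tbarq V q : lmodType K) q.
have : (f \o L : {linear _ -> _}) = g \o L.
  by apply: Tbarq_linmap_ext => x w; exact: fg.
by move/(congr1 (fun h : {linear _ -> _} => h z)).
Qed.

Section Lift.
Variables (q : nat) (W : lmodType K) (h : T -> {ffun 'I_q -> dual} -> W).
Hypothesis hl : forall w, linear (h^~ w).
Hypothesis hm : forall x, multilinear (h x).
Hypothesis hb : forall s x w,
  h (opR V (sinf_perm s) x) w = h x (reidx w s^-1%g).

Lemma Tbarq_lift1_linear : linear (fun x => tpow_lift (hm x)).
Proof.
move=> a x y; apply: tpow_ext => w.
by rewrite linmapDE linmapZE !tpow_liftE hl.
Qed.

Lemma Tbarq_lift_balanced s x t :
  mk_linear Tbarq_lift1_linear (Tbar_act V (sinf_perm s) x) t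
  = mk_linear Tbarq_lift1_linear x (@dual_act K V q s t).
Proof.
have : tpow_lift (hm (Tbar_act V (sinf_perm s) x))
    = tpow_lift (hm x) \o @dual_act K V q s.
  apply: tpow_ext => w; rewrite tpow_liftE.
  rewrite -[RHS]/(tpow_lift (hm x) (tpow_perm dual s^-1%g (tpure w))).
  by rewrite tpow_permE tpow_liftE -hb opR.unlock.
by move/(congr1 (fun h : {linear _ -> _} => h t)).
Qed.

Definition Tbarq_lift : {linear Tbarq V q -> W} := tens_lift Tbarq_lift_balanced.

Lemma Tbarq_liftE x w : Tbarq_lift (Tbarten x w) = h x w.
Proof.
rewrite Tbarten.unlock /Tbarq_lift tens_liftE.
by rewrite -[LHS]/(tpow_lift (hm x) (tpure w)) tpow_liftE.
Qed.

End Lift.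

Definition normal_op q (x : T) (w : {ffun 'I_q -> dual}) : EndT :=
  opL x * annih w.

Lemma normal_op_linear q (w : {ffun 'I_q -> dual}) :
  linear (fun x => normal_op x w).
Proof. by move=> a x y; rewrite /normal_op opL_linear mulrDl linendZl. Qed.

Lemma normal_op_multilinear q x : multilinear (@normal_op q x).
Proof.
move=> w i a y z.
by rewrite /normal_op annih_multilinear linend_mul_linear.
Qed.

(** L(x sigma) = L(x) L(sigma), and L(sigma) then permutes the annihilators. *)
Lemma normal_op_balanced q s x w :
  @normal_op q (opR V (sinf_perm s) x) w = normal_op x (reidx w s^-1%g).
Proof. by rewrite /normal_op opL_opR -mulrA annih_perm. Qed.

Definition Psi_q q : {linear Tbarq V q -> EndT} :=
  Tbarq_lift (@normal_op_linear q) (@normal_op_multilinear q)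
    (@normal_op_balanced q).

Lemma Psi_qE q x (w : {ffun 'I_q -> dual}) :
  Psi_q q (Tbarten x w) = opL x * annih w.
Proof. exact: Tbarq_liftE. Qed.

Definition Psi : {linear Tsingle V -> EndT} :=
  dsum_lift (M := fun q : nat => Tbarq V q : lmodType K) Psi_q.

Lemma Psi_in q z : Psi (Tsingle_in V q z) = Psi_q q z.
Proof. by rewrite Tsingle_in.unlock; exact: dsum_liftE. Qed.

Lemma PsiE q x (w : {ffun 'I_q -> dual}) :
  Psi (Tsingle_in V q (Tbarten x w)) = opL x * annih w.
Proof. by rewrite Psi_in Psi_qE. Qed.

End NormalOrder.

(** * Injectivity of Psi *)

Section Faithful.
Variables (K : fieldType) (V : vectType K).
Local Notation T := (Tbar V).
Local Notation dual := (dual V).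
Local Notation EndT := {linear T -> T}.
Local Notation n := (\dim {:V}).

Lemma eval_linear (y : T) : linear (fun f : EndT => f y).
Proof. by []. Qed.

Definition eval_at (y : T) : {linear EndT -> T} := mk_linear (eval_linear y).

Lemma Psi_q_lt q p (v : {ffun 'I_p -> V}) s (z : Tbarq V q) :
  (p < q)%N -> Psi_q V q z (Tmono v s) = 0.
Proof.
move=> pq; have : (eval_at (Tmono v s) \o Psi_q V q : {linear _ -> _}) = 0.
  apply: Tbarq_linmap_ext => x w.
  rewrite -[LHS]/(Psi_q V q (Tbarten x w) (Tmono v s)).
  by rewrite Psi_qE linendME annih_lt // linear0.
by move/(congr1 (fun h : {linear _ -> _} => h z)).
Qed.

(** For z = x (x) w the left side is the contraction of the pairing
y (x) u |-> x y (x) u, which is q! times the value of that pairing at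
1 (x) w. *)
Lemma Psi_q_recover q (z : Tbarq V q) :
  \sum_(I : {ffun 'I_q -> 'I_n}) Tbarten (Psi_q V q z (Tbasis I)) (dbasis I)
  = (q`!)%:R *: z.
Proof.
have lhs_linear : linear (fun z : Tbarq V q =>
    \sum_(I : {ffun 'I_q -> 'I_n})
      Tbarten (Psi_q V q z (Tbasis I)) (dbasis I)).
  move=> a y y'; rewrite (eq_bigr (fun I : {ffun 'I_q -> 'I_n} =>
      a *: Tbarten (Psi_q V q y (Tbasis I)) (dbasis I)
      + Tbarten (Psi_q V q y' (Tbasis I)) (dbasis I))); last first.
    by move=> I _; rewrite linearP linmapDE linmapZE Tbarten_linear.
  by rewrite big_split /= -scaler_sumr.
have rhs_linear : linear (fun z : Tbarq V q => (q`!)%:R *: z).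
  by move=> a y y'; rewrite scalerDr !scalerA mulrC.
rewrite -[LHS]/(mk_linear lhs_linear z) -[RHS]/(mk_linear rhs_linear z).
congr (_ z); congr GRing.Linear.sort; apply: Tbarq_linmap_ext => x w.
rewrite -[LHS]/(\sum_(I : {ffun 'I_q -> 'I_n})
  Tbarten (Psi_q V q (Tbarten x w) (Tbasis I)) (dbasis I)).
rewrite -[RHS]/(_ *: Tbarten x w).
pose B y u : Tbarq V q := Tbarten (opL x y) u.
have := @contraction K V (Tbarq V q) q B w; rewrite /B -opR_opL.
under eq_bigr do rewrite -linendME -Psi_qE.
have -> : opR V 1%g x = x by rewrite opR1.
apply.
- by move=> u a y y'; rewrite linearP Tbarten_linear.
- by move=> y; exact: Tbarten_multilinear.
- by move=> s y u; rewrite opL_opR_app Tbarten_balanced.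
Qed.

Lemma Psi_coord (x : Tsingle V) (y : T) :
  Psi V x y = \sum_(q <- dsupp x) Psi_q V q (x q) y.
Proof.
by rewrite -[LHS]/(eval_at y (\sum_(q <- dsupp x) Psi_q V q (x q))) linear_sum.
Qed.

(** Strong induction on q: on degree q, components of larger index act by 0 and
those of smaller index vanish by induction, so the component of index q acts by
0 there, and [Psi_q_recover] applies. *)
Lemma Psi_inj : [pchar K] =i pred0 -> injective (Psi V).
Proof.
move=> K0; apply: raddf_inj => x Psix0; apply: dsum_ext => q; rewrite dsum0E.
have [m] := ubnP q; elim: m q => // m IH q; rewrite ltnS => qm.
have [qx|/dsuppP //] := boolP (q \in dsupp x).
have Pq0 (I : {ffun 'I_q -> 'I_n}) : Psi_q V q (x q) (Tbasis I) = 0.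
  have := Psi_coord x (Tbasis I).
  rewrite Psix0 linmap0E (bigD1_seq q) ?undup_uniq // big1.
    by move/esym/(etrans (esym (addr0 _))).
  move=> q' q'Nq.
  have : (q' != q)%N := q'Nq; rewrite neq_ltn => /orP[q'q|qq']; last first.
    exact: (@Psi_q_lt q' q _ 1%g (x q') qq').
  by rewrite (IH q' (leq_trans q'q qm)) linear0.
have := Psi_q_recover (x q).
rewrite big1 => [/esym/eqP|I _]; last first.
  by rewrite Pq0; exact: (linear0 (mk_linear (Tbarten_linear (dbasis I)))).
by rewrite scaler_eq0 (pcharf0P K).1 // eqn0Ngt fact_gt0 => /eqP.
Qed.

End Faithful.

(** * The two direct sums are isomorphic *)

HB.lock Definition Tpqten (K : fieldType) (V : vectType K) (p q : nat)
  (m : Tp V p) (w : {ffun 'I_q -> dual V}) : Tdouble V :=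
  dsum_in (fun pq : nat * nat => Tpq V pq.1 pq.2 : lmodType K) (p, q)
    (tensor _ _ m (tpure w)).

Section Identification.
Variables (K : fieldType) (V : vectType K).
Local Notation T := (Tbar V).
Local Notation dual := (dual V).

Lemma Tpqten_linear p q (w : {ffun 'I_q -> dual}) :
  linear (fun m : Tp V p => Tpqten m w).
Proof.
move=> a x y; rewrite Tpqten.unlock -linearP; congr (dsum_in _ _ _).
exact: tensorPl.
Qed.

Lemma Tpqten_multilinear p q (m : Tp V p) :
  multilinear (fun w : {ffun 'I_q -> dual} => Tpqten m w).
Proof.
move=> w i a y z; rewrite Tpqten.unlock -linearP tpure_multilinear.
by congr (dsum_in _ _ _); exact: tensorPr.
Qed.

Lemma Tpqten_balanced p q (s : 'S_q) (m : Tp V p) (w : {ffun 'I_q -> dual}) :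
  Tpqten (Tp_act V p (sinf_perm s) m) w = Tpqten m (reidx w s^-1%g).
Proof.
have B := tensorB (fun s : 'S_q => Tp_act V p (sinf_perm s)) (@dual_act K V q)
  s m (tpure w).
have D : dual_act V s (tpure w) = tpure (reidx w s^-1%g) by exact: tpow_permE.
by rewrite Tpqten.unlock -D -B.
Qed.

Lemma Tdouble_linmap_ext (W : lmodType K) (f g : {linear Tdouble V -> W}) :
  (forall p q (v : {ffun 'I_p -> V}) s (w : {ffun 'I_q -> dual}),
    f (Tpqten (Tpure v s) w) = g (Tpqten (Tpure v s) w)) -> f = g.
Proof.
move=> fg; have {}fg p q (m : Tp V p) (w : {ffun 'I_q -> dual}) :
    f (Tpqten m w) = g (Tpqten m w).
  have lin (k : {linear Tdouble V -> W}) :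
      linear (fun m : Tp V p => k (Tpqten m w)).
    by move=> a y z; rewrite Tpqten_linear (linearP k).
  rewrite -[LHS]/(mk_linear (lin f) m) -[RHS]/(mk_linear (lin g) m).
  congr (_ m); congr GRing.Linear.sort; apply: Tp_ext => v s.
  exact: fg.
rewrite Tpqten.unlock in fg; apply: dsum_linmap_ext => -[p q] z.
set L := dsum_in (fun pq : nat * nat => Tpq V pq.1 pq.2 : lmodType K) (p, q).
have : (f \o L : {linear _ -> _}) = g \o L.
  apply: tens_ext => m t.
  set L' := tensor_lin (fun s : 'S_q => Tp_act V p (sinf_perm s))
    (@dual_act K V q) m.
  have : (f \o (L \o L' : {linear _ -> _}) : {linear _ -> _})
      = g \o (L \o L' : {linear _ -> _}).
    by apply: tpow_ext => w; exact: fg.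
  by move/(congr1 (fun h : {linear _ -> _} => h t)).
by move/(congr1 (fun h : {linear _ -> _} => h z)).
Qed.

Lemma Tsingle_linmap_ext_mon (W : lmodType K) (f g : {linear Tsingle V -> W}) :
  (forall p q (v : {ffun 'I_p -> V}) s (w : {ffun 'I_q -> dual}),
    f (Tsingle_in V q (Tbarten (Tmono v s) w))
    = g (Tsingle_in V q (Tbarten (Tmono v s) w))) ->
  f = g.
Proof.
move=> fg; apply: Tsingle_linmap_ext => q x w.
have lin (k : {linear Tsingle V -> W}) :
    linear (fun x => k (Tsingle_in V q (Tbarten x w))).
  by move=> a y z; rewrite Tbarten_linear (linearP (Tsingle_in V q)) (linearP k).
rewrite -[LHS]/(mk_linear (lin f) x) -[RHS]/(mk_linear (lin g) x).
congr (_ x); congr GRing.Linear.sort; apply: Tbar_linmap_ext => p v s.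
exact: fg.
Qed.

Lemma Tdouble_pureE p q (v : {ffun 'I_p -> V}) s (w : {ffun 'I_q -> dual}) :
  Tdouble_pure v s w = Tpqten (Tpure v s) w.
Proof. by rewrite Tpqten.unlock. Qed.

Lemma Tsingle_pureE p q (v : {ffun 'I_p -> V}) s (w : {ffun 'I_q -> dual}) :
  Tsingle_pure v s w = Tsingle_in V q (Tbarten (Tmono v s) w).
Proof. by rewrite Tsingle_in.unlock Tbarten.unlock Tmono.unlock. Qed.

End Identification.

HB.lock Definition eta_curried (K : fieldType) (V : vectType K) (q : nat)
  (x : Tbar V) (w : {ffun 'I_q -> dual V}) : Tdouble V :=
  Tbar_lift (fun p => mk_linear (Tpqten_linear (p := p) w)) x.

Section Identification.
Variables (K : fieldType) (V : vectType K).
Local Notation T := (Tbar V).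
Local Notation dual := (dual V).

Section Theta.
Variables p q : nat.

Definition theta_curried (m : Tp V p) : {linear tpow dual q -> Tsingle V} :=
  Tsingle_in V q \o tensor_lin (fun s : 'S_q => Tbar_act V (sinf_perm s))
    (@dual_act K V q) (Tin V p m).

Lemma theta_curried_linear : linear theta_curried.
Proof.
move=> a x y; apply: tpow_ext => w; rewrite linmapDE linmapZE.
rewrite /theta_curried -[LHS]/(Tsingle_in V q (tensor _ _ _ _)) linearP tensorPl.
exact: (linearP (Tsingle_in V q)).
Qed.

Lemma theta_curried_balanced (s : 'S_q) m t :
  mk_linear theta_curried_linear (Tp_act V p (sinf_perm s) m) t
  = mk_linear theta_curried_linear m (@dual_act K V q s t).
Proof.
have B := tensorB (fun s : 'S_q => Tbar_act V (sinf_perm s)) (@dual_act K V q)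
  s (Tin V p m) t.
have E : Tin V p (Tp_act V p (sinf_perm s) m)
    = Tbar_act V (sinf_perm s) (Tin V p m).
  exact/esym/Tbar_liftE.
exact: (etrans (congr1 (fun y => Tsingle_in V q (tensor _ _ y t)) E)
  (congr1 _ B)).
Qed.

Definition theta_component : {linear Tpq V p q -> Tsingle V} :=
  tens_lift theta_curried_balanced.

End Theta.

Definition theta : {linear Tdouble V -> Tsingle V} :=
  dsum_lift (M := fun pq : nat * nat => Tpq V pq.1 pq.2 : lmodType K)
    (fun pq => theta_component pq.1 pq.2).

Lemma thetaE p q (v : {ffun 'I_p -> V}) s (w : {ffun 'I_q -> dual}) :
  theta (Tpqten (Tpure v s) w) = Tsingle_in V q (Tbarten (Tmono v s) w).
Proof.
rewrite Tpqten.unlock /theta dsum_liftE.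
rewrite -[LHS]/(theta_component p q (tensor _ _ _ _)).
by rewrite /theta_component tens_liftE Tbarten.unlock Tmono.unlock.
Qed.

Section Eta.
Variable q : nat.

Lemma eta_curried_mon p (v : {ffun 'I_p -> V}) s (w : {ffun 'I_q -> dual}) :
  eta_curried (Tmono v s) w = Tpqten (Tpure v s) w.
Proof. by rewrite eta_curried.unlock Tmono.unlock Tbar_liftE. Qed.

Lemma eta_curried_linear (w : {ffun 'I_q -> dual}) :
  linear (fun x : T => eta_curried x w).
Proof. by move=> a x y; rewrite eta_curried.unlock; exact: linearP. Qed.

Lemma eta_curried_multilinear x :
  multilinear (fun w : {ffun 'I_q -> dual} => eta_curried x w).
Proof.
move=> w i a y z.
have rhs_linear := scale_add_linear a (eta_curried_linear (repl w i y))
  (eta_curried_linear (repl w i z)).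
rewrite -[LHS]/(mk_linear (eta_curried_linear _) x).
rewrite -[RHS]/(mk_linear rhs_linear x).
congr (_ x); congr GRing.Linear.sort; apply: Tbar_linmap_ext => p v s.
rewrite -[LHS]/(eta_curried _ _).
rewrite -[RHS]/(a *: eta_curried _ _ + eta_curried _ _) !eta_curried_mon.
exact: Tpqten_multilinear.
Qed.

Lemma eta_curried_balanced (s : 'S_q) x (w : {ffun 'I_q -> dual}) :
  eta_curried (opR V (sinf_perm s) x) w = eta_curried x (reidx w s^-1%g).
Proof.
rewrite -[LHS]/((mk_linear (eta_curried_linear w) \o opR V (sinf_perm s)
  : {linear _ -> _}) x).
rewrite -[RHS]/(mk_linear (eta_curried_linear (reidx w s^-1%g)) x).
congr (_ x); congr GRing.Linear.sort; apply: Tbar_linmap_ext => p v t.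
have L := etrans (congr1 (fun y => eta_curried y w) (opR_mon (sinf_perm s) v t))
  (eta_curried_mon v _ w).
have A : Tp_act V p (sinf_perm s) (Tpure v t) = Tpure v (t * sinf_perm s)%g.
  exact: Tp_liftE.
have R := etrans (eta_curried_mon v t _)
  (esym (Tpqten_balanced s (Tpure v t) w)).
exact: (etrans L (esym (etrans R (congr1 (fun m => Tpqten m w) A)))).
Qed.

Definition eta_component : {linear Tbarq V q -> Tdouble V} :=
  Tbarq_lift eta_curried_linear eta_curried_multilinear eta_curried_balanced.

End Eta.

Definition eta : {linear Tsingle V -> Tdouble V} :=
  dsum_lift (M := fun q : nat => Tbarq V q : lmodType K) eta_component.

Lemma etaE p q (v : {ffun 'I_p -> V}) s (w : {ffun 'I_q -> dual}) :
  eta (Tsingle_in V q (Tbarten (Tmono v s) w)) = Tpqten (Tpure v s) w.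
Proof.
rewrite Tsingle_in.unlock /eta dsum_liftE /eta_component Tbarq_liftE.
exact: eta_curried_mon.
Qed.

Lemma thetaK : cancel theta eta.
Proof.
have E : (eta \o theta : {linear _ -> _}) = idfun.
  apply: Tdouble_linmap_ext => p q v s w.
  by rewrite -[LHS]/(eta (theta _)) thetaE etaE.
by move=> x; rewrite -[LHS]/((eta \o theta : {linear _ -> _}) x) E.
Qed.

Lemma etaK : cancel eta theta.
Proof.
have E : (theta \o eta : {linear _ -> _}) = idfun.
  apply: Tsingle_linmap_ext_mon => p q v s w.
  by rewrite -[LHS]/(theta (eta _)) etaE thetaE.
by move=> x; rewrite -[LHS]/((theta \o eta : {linear _ -> _}) x) E.
Qed.

End Identification.

(** * The image of Psi *)

Section Image.
Variables (K : fieldType) (V : vectType K).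
Local Notation T := (Tbar V).
Local Notation dual := (dual V).
Local Notation EndT := {linear T -> T}.

Lemma opVP (x : V) : opV x = Lvec x. Proof. by rewrite opV.unlock. Qed.
Lemma opSP s : opS V s = Lperm V s. Proof. by rewrite opS.unlock. Qed.
Lemma opAP (w : dual) : opA w = Ldual w. Proof. by rewrite opA.unlock. Qed.

Lemma calL_subalgebra : is_subalgebra (calL V).
Proof.
split=> [S [[S1 _ _] _]|a f g Cf Cg S SG|f g Cf Cg S SG] //.
  by case: (SG) => -[_ SL _] _; apply: SL; [apply: Cf|apply: Cg].
by case: (SG) => -[_ _ SM] _; apply: SM; [apply: Cf|apply: Cg].
Qed.

Lemma calL_gen (f : EndT) :
  (range (@Lvec K V) `|` range (@Ldual K V) `|` range (@Lperm K V)) f -> calL V f.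
Proof. by move=> Gf S [_]; apply. Qed.

Lemma calL_opV x : calL V (opV x).
Proof. by rewrite opVP; apply: calL_gen; left; left; exists x. Qed.

Lemma calL_opA (w : dual) : calL V (opA w).
Proof. by rewrite opAP; apply: calL_gen; left; right; exists w. Qed.

Lemma calL_opS s : calL V (opS V s).
Proof. by rewrite opSP; apply: calL_gen; right; exists s. Qed.

Lemma calL_submodule : is_submodule (calL V).
Proof.
have [C1 CL CM] := calL_subalgebra; split=> //.
by rewrite -[0](addNr 1) -scaleN1r; apply: CL.
Qed.

Lemma calL_prod n (F : 'I_n -> EndT) :
  (forall i, calL V (F i)) -> calL V (\prod_(i < n) F i).
Proof.
have [C1 _ CM] := calL_subalgebra => CF.
by apply: (big_ind (calL V)).
Qed.

Lemma Psi_calL (z : Tsingle V) : calL V (Psi V z).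
Proof.
have [_ _ CM] := calL_subalgebra.
apply: (linmap_mem_submodule calL_submodule).
apply: Tsingle_linmap_ext_mon => p q v s w.
rewrite -[LHS]/(lquot_pi (calL V) (Psi V _)) -[RHS]/0 PsiE.
apply: lquot_pi_sub; apply: (CM); last by apply: calL_prod => j; exact: calL_opA.
rewrite opL_monE; apply: (CM); last exact: calL_opS.
by apply: calL_prod => j; exact: calL_opV.
Qed.

Local Notation A := (range (Psi V)).

Lemma range_submodule : is_submodule A.
Proof.
split=> [|a _ _ [x _ <-] [y _ <-]]; first by exists 0; rewrite // linear0.
by exists (a *: x + y); rewrite // linearP.
Qed.

Definition stabilizes (f : EndT) := forall g, A g -> A (f * g).

Lemma range_normal q (x : T) (w : {ffun 'I_q -> dual}) : A (opL x * annih w).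
Proof. by exists (Tsingle_in V q (Tbarten x w)); rewrite // PsiE. Qed.

Lemma range_one : A 1.
Proof.
pose e : {ffun 'I_0 -> V} := [ffun=> 0].
pose w : {ffun 'I_0 -> dual} := [ffun=> 0].
suff <- : opL (Tmono e 1%g) * annih w = 1 by exact: range_normal.
by rewrite -opSE opS1 mul1r /annih big_ord0.
Qed.

Lemma stabilizes_mon (f : EndT) :
  (forall p q (v : {ffun 'I_p -> V}) s (w : {ffun 'I_q -> dual}),
    A (f * (opL (Tmono v s) * annih w))) -> stabilizes f.
Proof.
move=> fA _ [z _ <-].
rewrite -[f * Psi V z]/((linend_lmul f \o Psi V : {linear _ -> _}) z).
apply: (linmap_mem_submodule range_submodule).
apply: Tsingle_linmap_ext_mon => p q v s w.
rewrite -[LHS]/(lquot_pi A (f * Psi V _)) -[RHS]/0 PsiE.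
exact: lquot_pi_sub.
Qed.

Lemma stabilizes_opL (y : T) : stabilizes (opL y).
Proof.
apply: stabilizes_mon => p q v s w; rewrite mulrA -opL_opL.
exact: range_normal.
Qed.

Lemma stabilizes_opS s : stabilizes (opS V s).
Proof. by rewrite (opSE _ [ffun=> 0]); exact: stabilizes_opL. Qed.

Lemma stabilizes_opV x : stabilizes (opV x).
Proof. by rewrite opVE; exact: stabilizes_opL. Qed.

Lemma opA_opV_mul (w : dual) x (g : EndT) :
  opA w * (opV x * g) = (w x : K) *: g + opV x * (opS V sinf_swap * (opA w * g)).
Proof.
by apply: linmap_ext => y; rewrite linmapDE linmapZE !linendME opA_opV.
Qed.

(** Moving L(w_0) to the right through a monomial, by induction on its degree,
leaves scalar terms in which one letter is removed; once in degree 0 it joins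
the annihilators as their first factor. *)
Lemma stabilizes_opA (w0 : dual) : stabilizes (opA w0).
Proof.
apply: stabilizes_mon => p q v s w; move: p v s.
pose P y := A (opA w0 * (opL y * annih w)).
apply: (Tbar_mon_ind (P := P)) => [v s|x y IH]; rewrite /P.
  rewrite -opSE mulrA opA_opS -mulrA annih_cons (opSE _ [ffun=> 0]).
  exact: range_normal.
rewrite opVE opL_opL -opVE -mulrA opA_opV_mul.
have [_ AL] := range_submodule; apply: AL; first exact: range_normal.
by apply: stabilizes_opV; apply: stabilizes_opS.
Qed.

(** The operators that stabilise the image of Psi on the left form a subalgebra
containing the generators, and the image contains 1. *)
Lemma calL_range (f : EndT) : calL V f -> A f.
Proof.
have [A0 AL] := range_submodule.
move=> Cf; rewrite -[f]mulr1; apply: (Cf stabilizes); last exact: range_one.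
split; first split.
- by move=> g; rewrite mul1r.
- move=> a g h Sg Sh k Ak; rewrite mulrDl linendZl.
  by apply: AL; [apply: Sg|apply: Sh].
- by move=> g h Sg Sh k Ak; rewrite -mulrA; apply: Sg; apply: Sh.
move=> g [[[x _ <-]|[w _ <-]]|[s _ <-]].
- by rewrite -opVP; exact: stabilizes_opV.
- by rewrite -opAP; exact: stabilizes_opA.
- by rewrite -opSP; exact: stabilizes_opS.
Qed.

Lemma range_Psi : range (Psi V) = calL V.
Proof.
by apply/seteqP; split=> f; [move=> [z _ <-]; exact: Psi_calL|exact: calL_range].
Qed.

Lemma LwordE p q (v : {ffun 'I_p -> V}) s (w : {ffun 'I_q -> dual}) :
  Lword v s w = opL (Tmono v s) * annih w.
Proof. by rewrite opL_monE /annih opV.unlock opS.unlock opA.unlock. Qed.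

End Image.

(** * The identification *)

Lemma normal_order_identification (K : fieldType) (V : vectType K) :
  [pchar K] =i pred0 ->
  exists (theta : {linear Tdouble V -> Tsingle V})
         (Phi : {linear Tdouble V -> {linear Tbar V -> Tbar V}}),
  [/\ bijective theta,
      forall (p q : nat) (v : {ffun 'I_p -> V}) (s : sinf)
             (w : {ffun 'I_q -> dual V}),
        theta (Tdouble_pure v s w) = Tsingle_pure v s w,
      forall (p q : nat) (v : {ffun 'I_p -> V}) (s : sinf)
             (w : {ffun 'I_q -> dual V}),
        Phi (Tdouble_pure v s w) = Lword v s w,
      injective Phi
    & range Phi = calL V].
Proof.
move=> K0; exists (theta V), (Psi V \o theta V : {linear _ -> _}); split.
- by exists (eta V); [exact: thetaK|exact: etaK].
- by move=> p q v s w; rewrite Tdouble_pureE thetaE Tsingle_pureE.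
- move=> p q v s w; rewrite -[LHS]/(Psi V (theta V _)) Tdouble_pureE thetaE.
  by rewrite PsiE LwordE.
- exact: (inj_comp (Psi_inj K0) (can_inj (@thetaK _ V))).
rewrite -range_Psi; apply/seteqP; split=> f [z _ <-]; first by exists (theta V z).
by exists (eta V z) => //; rewrite -[LHS]/(Psi V (theta V _)) etaK.
Qed.

Theorem corollary2p6 (R : realType) (V : vectType R[i]) :
  exists (theta : {linear Tdouble V -> Tsingle V})
         (Phi : {linear Tdouble V -> {linear Tbar V -> Tbar V}}),
  [/\ bijective theta,
      forall (p q : nat) (v : {ffun 'I_p -> V}) (s : sinf)
             (w : {ffun 'I_q -> dual V}),
        theta (Tdouble_pure v s w) = Tsingle_pure v s w,
      forall (p q : nat) (v : {ffun 'I_p -> V}) (s : sinf)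
             (w : {ffun 'I_q -> dual V}),
        Phi (Tdouble_pure v s w) = Lword v s w,
      injective Phi
    & range Phi = calL V].
Proof. exact: normal_order_identification (Num.Theory.pchar_num _). Qed.
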